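(* Let $\{x_n\}_{n\ge1}$ be the LISA process on $\mathbb{R}$ with initial configuration $\{x_1,\dots,x_{n_0}\}$ and $$x_{n+1}=x_{\chi_n}+d_n(x_{\chi_n})\,\psi_{n+1},\qquad n\ge n_0,$$ where the $\psi_n$ are i.i.d. uniformly distributed on $(-1,1)$, as described in the context, and let $$\mu_n=\frac1n\sum_{k=1}^n \mathrm{Unif}\big(x_k-d_n(x_k),\,x_k+d_n(x_k)\big)$$ be the conditional distribution of $x_{n+1}$ given $x_1,\dots,x_n$. Then almost surely there exists a probability measure $\mu^*$ on $\mathbb{R}$ (in general random) such that $\mu_n\to\mu^*$ weakly as $n\to\infty$.
   Context: The initial configuration consists of $n_0\ge2$ fixed distinct points $x_1,\dots,x_{n_0}\in\mathbb{R}$. The random variables $\chi_n$ ($n\ge n_0$) are independent with $\chi_n$ uniform on $\{1,\dots,n\}$, and the sequence $\{\chi_n\}$ is independent of the i.i.d. sequence $\{\psi_n\}$. For $1\le k\le n$, $d_n(x_k)=\min\{|x_k-x_j|:1\le j\le n,\ j\ne k\}$. $\mathrm{Unif}(a,b)$ denotes the uniform distribution on the interval $(a,b)$. *)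

(* Defs.v *)
From HB Require Import structures.
From mathcomp Require Import all_boot all_order all_algebra.
From mathcomp Require Import all_classical all_reals all_analysis.

Set Implicit Arguments.
Unset Strict Implicit.
Unset Printing Implicit Defensive.

Import Order.TTheory GRing.Theory Num.Theory.
Import numFieldNormedType.Exports.

Local Open Scope classical_set_scope.
Local Open Scope ring_scope.

Section independence.
Context d (T : measurableType d) (R : realType) (P : probability T R).

(* Mutual independence of the subfamily indexed by [D]: product rule over
   every finite subset [s] of [D]. *)
Definition independent_seq d' (U : measurableType d') (D : set nat)
    (X : nat -> {RV P >-> U}) : Prop :=
  forall (s : seq nat) (A : nat -> set U),
    uniq s -> {in s, forall i, D i} -> (forall i, measurable (A i)) ->
    P (\big[setI/setT]_(i <- s) (X i @^-1` A i)) =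
    (\prod_(i <- s) P (X i @^-1` A i))%E.

Definition sigma_generated d' (U : measurableType d') (D : set nat)
    (X : nat -> {RV P >-> U}) : set (set T) :=
  <<s \bigcup_(n in D) preimage_set_system setT (X n) measurable >>.

Definition independent_systems (F G : set (set T)) : Prop :=
  forall A B, F A -> G B -> P (A `&` B) = (P A * P B)%E.

End independence.

Section distributions.
Context {R : realType}.

(* For [a < b] this does not distinguish (a, b) from [a, b]. In the degenerate
   case, where the formula for the density is meaningless, the point mass
   at [a] is taken. *)
Definition unif (a b : R) : probability (measurableTypeR R) R :=
  match pselect (a < b) with
  | left ab => uniform_prob ab
  | right _ => \d_(a : measurableTypeR R)
  end.

Definition weak_cvg (mu : nat -> {measure set (measurableTypeR R) -> \bar R})
    (nu : {measure set (measurableTypeR R) -> \bar R}) : Prop :=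
  forall f : R -> R, continuous f -> bounded_fun f ->
    (\int[mu n]_y (f y)%:E @[n --> \oo] --> \int[nu]_y (f y)%:E)%E.

End distributions.

(* Sequences of points are indexed from 1: the value at 0 is never used. *)
Section lisa.
Context {R : realType}.

(* The minimum is taken in \bar R so that the neutral element +oo does not
   interfere; the result is finite as soon as [2 <= n]. *)
Definition nn_dist (x : nat -> R) (n k : nat) : R :=
  fine (\big[Order.min/+oo%E]_(1 <= j < n.+1 | j != k) (`|x k - x j|)%:E).

Definition lisa_mu (x : nat -> R) (n : nat) :
    {measure set (measurableTypeR R) -> \bar R} :=
  measure_function.mscale (n%:R^-1)%:nng
    (msum (fun i => unif (x i.+1 - nn_dist x n i.+1)
                         (x i.+1 + nn_dist x n i.+1)) n).

Context d (T : measurableType d) (P : probability T R).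

Definition uniform_1n (n : nat) (X : {RV P >-> nat}) : Prop :=
  (forall t, (1 <= X t <= n)%N) /\
  forall k, (1 <= k <= n)%N -> P (X @^-1` [set k]) = (n%:R^-1)%:E.

Definition has_law (X : {RV P >-> measurableTypeR R})
    (mu : probability (measurableTypeR R) R) : Prop :=
  forall A, measurable A -> distribution P X A = mu A.

Record is_lisa (n0 : nat) (pts : n0.-tuple R) (chi : nat -> {RV P >-> nat})
    (psi : nat -> {RV P >-> measurableTypeR R}) (x : nat -> T -> R) : Prop := {
  lisa_chi_unif : forall n, (n0 <= n)%N -> uniform_1n n (chi n) ;
  lisa_chi_indep : independent_seq [set n | (n0 <= n)%N] chi ;
  lisa_psi_law : forall n, (n0 < n)%N -> has_law (psi n) (unif (-1) 1) ;
  lisa_psi_indep : independent_seq [set n | (n0 < n)%N] psi ;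
  lisa_chi_psi_indep : independent_systems P
    (sigma_generated [set n | (n0 <= n)%N] chi)
    (sigma_generated [set n | (n0 < n)%N] psi) ;
  lisa_init : forall (i : 'I_n0) t, x i.+1 t = tnth pts i ;
  lisa_step : forall n t, (n0 <= n)%N ->
    x n.+1 t = x (chi n t) t + nn_dist (x ^~ t) n (chi n t) * psi n.+1 t
}.

End lisa.

(* Main.v *)
From HB Require Import structures.
Require Import Defs.
From mathcomp Require Import all_boot all_order all_algebra.
From mathcomp Require Import all_classical all_reals all_analysis.
From mathcomp Require Import measurable_realfun.
From mathcomp Require Import ring lra zify.

(** Write [nu_n] for the empirical measure of [x_1, ..., x_n], [S_n] for the sum
    of the nearest-neighbour distances [d_n(x_k)], and call
    [e_n = d_n(x_chi) |psi_(n+1)|] the length of the step taken at time [n].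

    Two facts drive the proof.  First, the parent of the new point is a uniform
    choice among the existing ones, so [nu_(n+1) f - nu_n f] is [1/(n+1)] times
    a martingale increment, up to the error made by replacing [f (x_(n+1))]
    with the value of [f] at the parent; for a Lipschitz [f] this error is at
    most a constant times [e_n / (n+1)].  Secondly, the errors are summable:
    adding a point can only decrease the distances of the uninvolved points,
    while the parent and the new point end up at distance at most [e_n] from
    their nearest neighbours, so [S_(n+1) <= S_n - d_n(x_chi) + 2 e_n], and
    since [E|psi| = 1/2] exactly, [E S_n] does not increase
    ([integral_nn_sum_nonincr]).  Hence [E e_n = O(1/n)] and
    [sum_n e_n / (n+1)] is almost surely finite ([ae_jump_summable]); Kronecker's
    lemma then gives [S_n / n -> 0] ([ae_nn_mean_cvg0]).

    The convergence of the martingale part is obtained along the cubes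
    [n = k^3], where the variance of the increments is [O(k^-4)]: this is small
    enough for summability of the increments themselves
    ([ae_martingale_cubes]).  For [f >= 0] the sums [n nu_n f] are nondecreasing
    and consecutive cubes have ratio tending to [1], so convergence along the
    cubes is convergence ([ae_emp_mean_cvg]).

    This is applied to the countably many ramps that go from [1] to [0] between
    two rationals, and to the unbounded function [sqrt (1 + |x|)], whose square
    has bounded expected mean under [nu_n].  Up to [S_n / n], the distribution function
    of [mu_n] is squeezed between the [nu_n]-means of ramps, and the means of
    [sqrt (1 + |x|)] give tightness.  What remains is Helly's construction of
    the limiting distribution function ([limit_law_exists]) and the weak
    convergence that it implies ([weak_cvg_cumul]). *)

Set Implicit Arguments.
Unset Strict Implicit.
Unset Printing Implicit Defensive.

Import Order.TTheory GRing.Theory Num.Theory.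
Import numFieldNormedType.Exports.

Local Open Scope classical_set_scope.
Local Open Scope ring_scope.

(** * Real sequences and partial sums *)

Section real_sequences.
Context {R : realType}.
Implicit Types (a u v : nat -> R).

(** Compare with the telescoping [1 / (k - 1) - 1 / k]. *)
Lemma sum_inv_sqr_le1 m N : (2 <= m)%N ->
  \sum_(m <= k < N) (k%:R ^+ 2)^-1 <= 1 :> R.
Proof.
move=> m2; have [Nm|mN] := leqP N m; first by rewrite big_geq.
apply: (@le_trans _ _ (\sum_(m <= k < N) (- (k%:R^-1) - - (k.-1%:R^-1)))).
  apply: ler_sum_nat => k /andP[mk _]; case: k mk => [|[|k]] mk; try lia.
  rewrite /= opprK addrC -(@natr1 _ k.+1); set z : R := k.+1%:R.
  have z0 : 0 < z by rewrite ltr0n.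
  rewrite -subr_ge0.
  rewrite (_ : _ - _ = (z * (z + 1) ^+ 2)^-1); last by field; apply/andP; split; lra.
  by rewrite invr_ge0 mulr_ge0// ?sqr_ge0// ltW.
case: m m2 mN => [//|m] m2 mN; case: N mN => [//|N] mN.
rewrite big_add1/= telescope_sumr//; last by lia.
rewrite opprK addrC lerBlDr; apply: (@le_trans _ _ 1); last by rewrite lerDl invr_ge0.
by rewrite invf_le1 ?ltr0n ?ler1n//; lia.
Qed.

Lemma cvgn_bounded_partial_sums m a (M : R) :
  (forall k, 0 <= a k) -> (forall N, \sum_(m <= k < N) a k <= M) ->
  cvgn (fun N => \sum_(m <= k < N) a k).
Proof.
move=> a0 aM; apply: nondecreasing_is_cvgn.
  move=> p q pq; have [mp|pm] := leqP m p.
    by rewrite (big_cat_nat mp pq)//= lerDl; exact: sumr_ge0.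
  by rewrite big_geq ?(ltnW pm)//; exact: sumr_ge0.
by exists M => _ [N _ <-].
Qed.

Lemma cvgn_bounded_variation m v (M : R) :
  (forall N, \sum_(m <= k < N) `|v k.+1 - v k| <= M) -> cvgn v.
Proof.
move=> vM; pose w := fun k => v (k + m)%N.
suff : cvgn (series (telescope w)).
  rewrite telescopeK => /cvg_ex[l /= wl]; apply/cvg_ex; exists (l + w 0%N).
  rewrite -(cvg_shiftn m).
  rewrite (_ : (fun n => v (n + m)%N) = (fun n => w n - w 0%N + w 0%N)).
    by apply: cvgD => //; exact: cvg_cst.
  by apply/funext => n; rewrite subrK.
apply: normed_cvg; apply: (@cvgn_bounded_partial_sums 0%N (fun k => `|telescope w k|) M) => // N.
apply: le_trans (vM (N + m)%N).
by rewrite -{1}(add0n m) big_addn addnK.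
Qed.

(** A weighted [l2] bound on the increments gives bounded variation because
    [2 |z| <= k^2 z^2 + k^-2].  Second moments of martingale increments are
    easy to bound, and enter through this lemma. *)
Lemma cvgn_weighted_variation m v (M : R) : (2 <= m)%N ->
  (forall N, \sum_(m <= k < N) k%:R ^+ 2 * (v k.+1 - v k) ^+ 2 <= M) -> cvgn v.
Proof.
move=> m2 vM; apply: (@cvgn_bounded_variation m _ (M + 1)) => N.
apply: le_trans (lerD (vM N) (sum_inv_sqr_le1 N m2)).
rewrite -big_split/=; apply: ler_sum_nat => k /andP[mk _].
have k0 : 0 < k%:R :> R by rewrite ltr0n; lia.
set z := v k.+1 - v k.
rewrite -(real_normK (num_real z)); have := normr_ge0 z; set y := `|z| => y0.
have := sqr_ge0 (k%:R * y - k%:R^-1).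
rewrite (_ : _ ^+ 2 = k%:R ^+ 2 * y ^+ 2 - 2 * y + (k%:R ^+ 2)^-1); first lra.
by field; rewrite gt_eqF.
Qed.

(** Kronecker's lemma: summation by parts turns the mean into [A n] minus a
    Cesaro mean of the convergent partial sums [A]. *)
Lemma kronecker m a (M : R) : (forall k, 0 <= a k) ->
  (forall N, \sum_(m <= k < N) a k / k.+1%:R <= M) ->
  n%:R^-1 * \sum_(m <= k < n) a k @[n --> \oo] --> 0.
Proof.
move=> a0 aM; pose A N := \sum_(m <= k < N) a k / k.+1%:R.
have [l Al] : exists l : R, A @ \oo --> l.
  apply/cvg_ex; apply: cvgn_bounded_partial_sums aM => k.
  by rewrite divr_ge0.
have sumE N : \sum_(m <= k < N) a k = N%:R * A N - \sum_(0 <= k < N) A k.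
  elim: N => [|N IH]; first by rewrite !big_geq// mul0r subr0.
  have [mN|Nm] := leqP m N; last first.
    rewrite big_geq// /A big_geq// mulr0 sub0r big_nat big1 ?oppr0// => k /andP[_ kN].
    by rewrite big_geq//; lia.
  rewrite big_nat_recr//= IH big_nat_recr//= /A big_nat_recr//= -/(A N).
  by rewrite -natr1; field; rewrite natr1 pnatr_eq0.
have AS : A n.+1 @[n --> \oo] --> l by rewrite (cvg_shiftS A).
have lim0 := cvgB AS (cesaro Al); rewrite subrr in lim0.
rewrite -cvg_shiftS.
rewrite [X in X @ _ --> _](_ : _ = (fun n => A n.+1) - arithmetic_mean A); first exact: lim0.
by apply/funext => n /=; rewrite sumE mulrBr mulKf// pnatr_eq0.
Qed.

Lemma cube_bracket n : exists k, (k ^ 3 <= n < k.+1 ^ 3)%N.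
Proof.
have ex : exists k, (k ^ 3 <= n)%N by exists 0%N.
have ub k : (k ^ 3 <= n)%N -> (k <= n)%N.
  by move=> /(leq_trans _); apply; case: k => // k; rewrite -{1}(expn1 k.+1) leq_pexp2l.
case: (ex_maxnP ex ub) => k kn kmax; exists k; rewrite kn/= ltnNge.
by apply/negP => /kmax; rewrite ltnn.
Qed.

(** Between [k ^ 3] and [k.+1 ^ 3] a monotone [S] is pinned by its values at the
    two cubes, whose ratio tends to [1]. *)
Lemma cvgn_mean_cubes (S : nat -> R) (l : R) :
  (forall n, 0 <= S n) -> {homo S : m n / (m <= n)%N >-> m <= n} ->
  (k ^ 3)%:R^-1 * S (k ^ 3)%N @[k --> \oo] --> l ->
  n%:R^-1 * S n @[n --> \oo] --> l.
Proof.
move=> S0 ndS Sl; have [kappa kappaP] := choice cube_bracket.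
have kappaoo : kappa n @[n --> \oo] --> \oo.
  apply/cvgnyPge => A; near=> n.
  have /andP[_ nk] := kappaP n.
  have : (A ^ 3 < (kappa n).+1 ^ 3)%N.
    by apply: leq_ltn_trans nk; near: n; exact: nbhs_infty_ge.
  by rewrite ltn_exp2r.
pose r k : R := (1 - harmonic k) ^+ 3.
have rl : r @ \oo --> (1 : R).
  have h1 : (1 - harmonic k : R) @[k --> \oo] --> (1 : R).
    have := cvgB (@cvg_cst _ (1 : R) _ \oo _) (@cvg_harmonic R).
    by rewrite subr0 => lim1; exact: lim1.
  have := cvgM (cvgM h1 h1) h1; rewrite !mulr1 => h3.
  rewrite (_ : r = fun k => (1 - harmonic k) * (1 - harmonic k) * (1 - harmonic k)).
    exact: h3.
  by apply/funext => k; rewrite /r !exprS mulrA mulr1.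
have rE k : r k = k%:R ^+ 3 / k.+1%:R ^+ 3.
  rewrite /r /harmonic/= -expr_div_n; congr (_ ^+ 3).
  by rewrite -natr1; field; rewrite natr1 pnatr_eq0.
pose U k := (k ^ 3)%:R^-1 * S (k ^ 3)%N.
have Ul : U @ \oo --> l by [].
apply: (@squeeze_cvgr _ _ _ _ (fun n => U (kappa n) * r (kappa n))
  (fun n => U (kappa n).+1 * (r (kappa n))^-1)).
- near=> n.
  have k0 : (0 < kappa n)%N.
    by near: n; have /cvgnyPge := kappaoo; apply.
  have /andP[kn nk] := kappaP n.
  have n0 : (0 < n)%N by rewrite (leq_trans _ kn)// expn_gt0 k0.
  have z0 : (kappa n)%:R != 0 :> R by rewrite pnatr_eq0 -lt0n.
  have w0 : (kappa n).+1%:R != 0 :> R by rewrite pnatr_eq0.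
  rewrite !rE /U !natrX; apply/andP; split.
    rewrite [X in X <= _](_ : _ = S (kappa n ^ 3)%N / (kappa n).+1%:R ^+ 3); last first.
      by move: z0 w0; move: (_%:R) (_.+1%:R) => z w z0 w0; field; rewrite z0 w0.
    rewrite mulrC ler_pM ?invr_ge0 ?exprn_ge0//.
      by rewrite lef_pV2 ?posrE ?exprn_gt0 ?ltr0n// -natrX ler_nat ltnW.
    exact: ndS.
  rewrite [X in _ <= X](_ : _ = S ((kappa n).+1 ^ 3)%N / (kappa n)%:R ^+ 3); last first.
    by move: z0 w0; move: (_%:R) (_.+1%:R) => z w z0 w0; field; rewrite z0 w0.
  rewrite mulrC ler_pM ?invr_ge0//.
    by apply: ndS; exact: ltnW.
  by rewrite lef_pV2 ?posrE ?exprn_gt0 ?ltr0n// -natrX ler_nat.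
- apply: (cvg_comp kappa (fun k => U k * r k) kappaoo).
  by have := cvgM Ul rl; rewrite mulr1 => lim; exact: lim.
- apply: (cvg_comp kappa (fun k => U k.+1 * (r k)^-1) kappaoo).
  have US : U k.+1 @[k --> \oo] --> l by rewrite (cvg_shiftS U).
  by have := cvgM US (cvgV (@oner_neq0 R) rl); rewrite invr1 mulr1 => lim; exact: lim.
Unshelve. all: by end_near.
Qed.

End real_sequences.

(** * Almost sure summability *)

Section summability_ae.
Context d (T : measurableType d) (R : realType)
  (mu : {measure set T -> \bar R}).
Local Open Scope ereal_scope.

(** By monotone convergence the sum of the series has a finite integral. *)
Lemma ae_bounded_partial_sums m (a : nat -> T -> R) (K : R) :
  (forall k t, (0 <= a k t)%R) ->
  (forall k, (m <= k)%N -> measurable_fun setT (a k)) ->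
  (forall N, \sum_(m <= k < N) \int[mu]_t (a k t)%:E <= K%:E) ->
  {ae mu, forall t, exists M : R, forall N, (\sum_(m <= k < N) a k t <= M)%R}.
Proof.
move=> a0 ma aK.
pose b k t := if (m <= k)%N then a k t else 0%R.
have mb k : measurable_fun setT (EFin \o b k).
  apply/measurable_EFinP; rewrite /b.
  by have [mk|_] := boolP (m <= k)%N; [exact: ma|exact: measurable_cst].
have b0 k t : 0 <= (b k t)%:E by rewrite lee_fin /b; case: ifP.
have sumE N t : (\sum_(m <= k < N) a k t)%:E = \sum_(m <= k < N) (b k t)%:E.
  by rewrite -sumEFin; apply: eq_big_nat => k /andP[mk _]; rewrite /b mk.
pose g N t := \sum_(m <= k < N) (b k t)%:E.
have mg N : measurable_fun setT (g N) by apply: emeasurable_sum => k; exact: mb.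
have g0 N t : 0 <= g N t by apply: sume_ge0 => k _; exact: b0.
have ndg t : {homo g ^~ t : p q / (p <= q)%N >-> p <= q}.
  by move=> p q pq; apply: lee_sum_nneg_natr => // k _ _; exact: b0.
have int_lim : \int[mu]_t limn (g ^~ t) <= K%:E.
  have -> : \int[mu]_t limn (g ^~ t) = limn (fun N => \int[mu]_t g N t).
    by apply: monotone_convergence => // t _; exact: ndg.
  apply: lime_le.
    apply: ereal_nondecreasing_is_cvgn => p q pq.
    by apply: ge0_le_integral => // t _; exact: ndg.
  apply: nearW => N; rewrite ge0_integral_sum//; apply: le_trans (aK N).
  by rewrite le_eqVlt; apply/orP; left; apply/eqP; apply: eq_big_nat => k /andP[mk _];
    rewrite /b mk.
have mlim : measurable_fun setT (fun t => limn (g ^~ t)).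
  apply: (emeasurable_fun_cvg g) => // t _.
  by apply: ereal_nondecreasing_is_cvgn; exact: ndg.
have lim0 t : 0 <= limn (g ^~ t).
  by apply: lime_ge; [exact: ereal_nondecreasing_is_cvgn|exact: nearW].
have : mu.-integrable setT (fun t => limn (g ^~ t)).
  apply/integrableP; split => //.
  under eq_integral do rewrite gee0_abs//.
  by rewrite (le_lt_trans int_lim)// ltry.
move/(integrable_ae measurableT); apply: filterS => t /(_ I) limfin.
exists (fine (limn (g ^~ t))) => N.
rewrite -lee_fin fineK// sumE.
rewrite (cvg_lim _ (ereal_nondecreasing_cvgn (ndg t)))//.
by apply: ereal_sup_ubound; exists N.
Qed.

End summability_ae.

(** * Nearest-neighbour distances and empirical means *)

Section nearest_neighbour.
Context {R : realType}.
Implicit Types (x : nat -> R) (n k : nat).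

Let nnd x n k : \bar R :=
  \big[Order.min/+oo%E]_(1 <= j < n.+1 | j != k) `|x k - x j|%:E.

Let nnd_le x n k j : (1 <= j <= n)%N -> j != k ->
  (nnd x n k <= `|x k - x j|%:E)%E.
Proof.
move=> jn jk.
by apply: (@ge_bigmin_seq _ _ _ _ _ j (fun j => j != k)
  (fun j => `|x k - x j|%:E)); rewrite ?mem_index_iota.
Qed.

Let nnd_ge0 x n k : (0 <= nnd x n k)%E.
Proof. by apply: le_bigmin => // j _; rewrite lee_fin. Qed.

Let nnd_fin x n k : (2 <= n)%N -> nnd x n k \is a fin_num.
Proof.
move=> n2; rewrite ge0_fin_numE//.
apply: (@le_lt_trans _ _ (`|x k - x (if k == 1 then 2 else 1)|%:E)); last exact: ltry.
by apply: nnd_le; [case: ifP => _; lia|case: ifP => [/eqP->|/negbT]; lia].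
Qed.

Lemma nn_dist_ge0 x n k : 0 <= nn_dist x n k.
Proof. by apply: fine_ge0; exact: nnd_ge0. Qed.

Lemma nn_dist_le x n k j : (2 <= n)%N -> (1 <= j <= n)%N -> j != k ->
  nn_dist x n k <= `|x k - x j|.
Proof. by move=> n2 jn jk; rewrite -lee_fin fineK ?nnd_fin//; exact: nnd_le. Qed.

Lemma nn_dist_nonincr x n k : (2 <= n)%N -> nn_dist x n.+1 k <= nn_dist x n k.
Proof.
move=> n2; apply: fine_le; [exact/nnd_fin/ltnW|exact: nnd_fin|].
apply: (@sub_bigmin_seq _ _ +oo%E) => j; by rewrite !mem_index_iota => /andP[-> /ltnW].
Qed.

Lemma eq_nn_dist x y n k : (forall j, (1 <= j <= n)%N -> x j = y j) ->
  (1 <= k <= n)%N -> nn_dist x n k = nn_dist y n k.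
Proof.
move=> xy kn; congr fine; rewrite [LHS]big_nat_cond [RHS]big_nat_cond.
by apply: eq_bigr => j /andP[jn _]; rewrite !xy.
Qed.

Definition nn_sum x n := \sum_(1 <= k < n.+1) nn_dist x n k.

Lemma nn_sum_ge0 x n : 0 <= nn_sum x n.
Proof. by apply: sumr_ge0 => k _; exact: nn_dist_ge0. Qed.

Lemma eq_nn_sum x y n : (forall j, (1 <= j <= n)%N -> x j = y j) ->
  nn_sum x n = nn_sum y n.
Proof. by move=> xy; apply: eq_big_nat => k kn; exact: eq_nn_dist. Qed.

(** Uninvolved points only get closer to their nearest neighbour, while the
    parent [c] and its child are at distance [nn_dist x n c * `|u|] from each
    other. *)
Lemma nn_sumS x n c u : (2 <= n)%N -> (1 <= c <= n)%N ->
  x n.+1 = x c + nn_dist x n c * u ->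
  nn_sum x n.+1 <= nn_sum x n - nn_dist x n c + 2 * (nn_dist x n c * `|u|).
Proof.
move=> n2 cn xS.
have xcS : `|x c - x n.+1| = nn_dist x n c * `|u|.
  by rewrite xS opprD addNKr normrN normrM (ger0_norm (nn_dist_ge0 _ _ _)).
have cS : c != n.+1 by lia.
rewrite /nn_sum big_nat_recr//= mulrDl mul1r addrA; apply: lerD; last first.
  by rewrite -xcS distrC; apply: nn_dist_le; [exact: ltnW|lia|].
rewrite !(bigD1_seq c) ?iota_uniq ?mem_index_iota//=.
rewrite (addrC (nn_dist x n c)) addrK addrC; apply: lerD.
  by apply: ler_sum => k _; exact: nn_dist_nonincr.
by rewrite -xcS; apply: nn_dist_le; [exact: ltnW|lia|rewrite eq_sym].
Qed.

Definition emp_mean (f : R -> R) x n : R :=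
  n%:R^-1 * \sum_(1 <= k < n.+1) f (x k).

Lemma emp_mean_ge0 f x n : (forall y, 0 <= f y) -> 0 <= emp_mean f x n.
Proof. by move=> f0; rewrite mulr_ge0 ?invr_ge0 ?sumr_ge0. Qed.

Lemma emp_meanS f x n : (0 < n)%N ->
  emp_mean f x n.+1 = emp_mean f x n + (f (x n.+1) - emp_mean f x n) / n.+1%:R.
Proof.
move=> n0; rewrite /emp_mean big_nat_recr//=; set s := \sum_(_ <= _ < _) _.
have : n%:R != 0 :> R by rewrite pnatr_eq0 -lt0n.
have : n%:R + 1 != 0 :> R by rewrite natr1 pnatr_eq0.
by rewrite -natr1; move: (n%:R : R) => z z1 z0; field; rewrite z0 z1.
Qed.

(** The cross term vanishes, the values [f (x k)] being centred at their mean: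
    averaged over a uniform choice of [k], squares of martingale increments
    add up. *)
Lemma emp_mean_sqr_le f x n (y c : R) : (0 < n)%N ->
  n%:R^-1 * \sum_(1 <= k < n.+1) (y + (f (x k) - emp_mean f x n) * c) ^+ 2 <=
  y ^+ 2 + emp_mean (fun z => f z ^+ 2) x n * c ^+ 2.
Proof.
move=> n0; set m := emp_mean f x n.
have nz : n%:R != 0 :> R by rewrite pnatr_eq0 -lt0n.
have sum1 : \sum_(1 <= k < n.+1) f (x k) = n%:R * m.
  by rewrite /m /emp_mean mulVKf.
have sum2 : \sum_(1 <= k < n.+1) f (x k) ^+ 2 = n%:R * emp_mean (fun z => f z ^+ 2) x n.
  by rewrite /emp_mean mulVKf.
rewrite (eq_bigr (fun k => (y - m * c) ^+ 2 + 2 * (y - m * c) * c * f (x k) +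
  c ^+ 2 * f (x k) ^+ 2)); last by move=> k _; ring.
rewrite !big_split/= -!mulr_sumr sum1 sum2.
rewrite sumr_const_nat subSS subn0 -(mulr_natr (y - m * c)).
move: (emp_mean (fun z => f z ^+ 2) x n) (n%:R : R) nz => v2 z z0.
clear sum1 sum2; clearbody m.
rewrite -subr_ge0 (_ : _ - _ = (m * c) ^+ 2); first exact: sqr_ge0.
by field.
Qed.

End nearest_neighbour.

(** * Independence and integrals of products *)

Section independence_factorization.
Context d d' (T : measurableType d) (U : measurableType d') (R : realType)
  (P : probability T R).
Local Open Scope ereal_scope.

(** Both sides are finite measures in [E] (the restriction of [P] to [C], and
    [P] scaled by [P C]), so agreement on a pi-system suffices. *)
Lemma independent_generated (G : set (set T)) (C : set T) :
  G `<=` measurable -> setI_closed G -> G setT -> measurable C ->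
  (forall E, G E -> P (E `&` C) = P E * P C) ->
  forall E, <<s G >> E -> P (E `&` C) = P E * P C.
Proof.
move=> Gm GI GT mC ind E sE.
pose c : {nonneg R} := NngNum (fine_ge0 (measure_ge0 P C)).
have cE : c%:num%:E = P C by rewrite /c/= fineK// fin_num_measure.
have -> : P E * P C = measure_function.mscale c P E.
  by rewrite /measure_function.mscale/= cE muleC.
rewrite -[LHS]/(mrestr P mC E).
apply: (@g_sigma_algebra_measure_unique _ _ _ G Gm (fun=> setT) _ _ (mrestr P mC) (measure_function.mscale c P)) => //.
- by apply/seteqP; split => // x _; exists 0%N.
- move=> A GA; rewrite -[LHS]/(P (A `&` C)) ind//.
  by rewrite -[RHS]/(c%:num%:E * P A) cE muleC.
- by move=> _; rewrite -[X in X < _]/(P (setT `&` C)) (le_lt_trans (probability_le1 _ _)) ?ltry// setTI.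
Qed.

(** The joint law of the identity, viewed as a map to [T] with the smaller
    sigma-algebra, and of [Y] is a product measure; conclude by Tonelli. *)
Lemma ge0_integral_indepM (G : set (set T)) (Y : {mfun T >-> U})
    (H : T -> \bar R) (g : U -> \bar R) :
  G `<=` measurable -> setI_closed G -> G setT ->
  (forall E B, G E -> measurable B ->
     P (E `&` Y @^-1` B) = P E * P (Y @^-1` B)) ->
  measurable_fun setT (H : g_sigma_algebraType G -> \bar R) -> (forall t, 0 <= H t) ->
  measurable_fun setT g -> (forall u, 0 <= g u) ->
  \int[P]_t (H t * g (Y t)) = \int[P]_t H t * \int[P]_t g (Y t).
Proof.
move=> Gm GI GT ind mH H0 mg g0.
pose T' := g_sigma_algebraType G.
have sGm : <<s G >> `<=` measurable.
  by apply: smallest_sub => //; exact: sigma_algebra_measurable.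
have mid : measurable_fun setT (idfun : T -> T').
  by move=> _ B mB; rewrite setTI; exact: sGm.
pose X : {mfun T >-> T'} := HB.pack (idfun : T -> T')
  (isMeasurableFun.Build _ _ _ _ _ mid).
have mZ : measurable_fun setT (fun t => (X t, Y t)).
  by apply: measurable_fun_pair.
pose Z : {mfun T >-> (T' * U)%type} := HB.pack (fun t => (X t, Y t))
  (isMeasurableFun.Build _ _ _ _ _ mZ).
have mHg : measurable_fun setT (fun z : T' * U => H z.1 * g z.2).
  by apply: emeasurable_funM; apply: measurableT_comp.
have Hg0 : forall z : T' * U, 0 <= H z.1 * g z.2 by move=> z; rewrite mule_ge0.
have -> : \int[P]_t (H t * g (Y t)) =
    \int[distribution P Z]_z (H z.1 * g z.2).
  by rewrite ge0_integral_distribution.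
rewrite -[\int[P]_t g (Y t)](@ge0_integral_distribution _ _ _ _ _ P Y g)//.
rewrite -[\int[P]_t H t](@ge0_integral_distribution _ _ _ _ _ P X H)//.
rewrite (eq_measure_integral (distribution P X \x distribution P Y)); last first.
  move=> A mA _; apply/esym/product_measure_unique => // B C mB mC.
  rewrite /distribution/= /pushforward/=.
  rewrite -(@independent_generated G (Y @^-1` C))//.
  by rewrite -[X in measurable X]setTI; exact: measurable_funP.
  by move=> E GE; exact: ind.
rewrite fubini_tonelli1// /fubini_F/=.
under eq_integral do rewrite ge0_integralZl//.
rewrite ge0_integralZr//; exact: integral_ge0.
Qed.

End independence_factorization.

(** * The absolute moment of the uniform law, and measurability of selections *)

Section absolute_moment.
Context {R : realType}.
Local Notation mu := lebesgue_measure.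
Local Open Scope ereal_scope.

Lemma integral_linear (c a b : R) : (a < b)%R ->
  \int[mu]_(y in `[a, b]) (c * y)%:E = (c * (b ^+ 2 - a ^+ 2) / 2)%:E.
Proof.
move=> ab; pose F (y : R) := (c * y ^+ 2 / 2)%R.
have dF y : is_derive (y : R^o) 1%R (F : R^o -> R^o) (c * y)%R.
  by rewrite /F; apply: is_derive_eq; rewrite /GRing.scale/=; field.
have cF : continuous F.
  by move=> y; apply: differentiable_continuous; apply/derivable1_diffP; apply: ex_derive.
rewrite (@continuous_FTC2 _ _ F)//; first by rewrite -EFinB /F; congr EFin; field.
- by apply: continuous_subspaceT => y; apply: cvgM; [exact: cvg_cst|exact: cvg_id].
- split.
  + by move=> y _; exact: ex_derive.
  + by apply: cvg_at_right_filter; exact: cF.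
  + by apply: cvg_at_left_filter; exact: cF.
- by move=> y _; rewrite derive1E derive_val.
Qed.

(** That this is [1/2] and not more is what keeps the expected sum of the
    nearest-neighbour distances from growing. *)
Lemma integral_normr_unif :
  \int[unif (-1) 1 : probability (measurableTypeR R) R]_y `|y|%:E = (2^-1)%:E.
Proof.
rewrite /unif; case: pselect => [H|]; last by rewrite gtrN.
have mabs D : measurable_fun D (fun y : R => `|y|%:E).
  by apply/measurable_EFinP; apply: measurable_funTS; exact: normr_measurable.
rewrite integral_uniform//=; last exact: mabs.
have split01 : [set` `[(-1)%R, 1%R]] = [set` `[(-1)%R, 0%R]] `|` [set` `]0%R, 1%R]] :> set R.
  by rewrite -itv_bndbnd_setU// bnd_simp; [exact: lerN10|exact: ler01].
rewrite split01 ge0_integral_setU//=; last 2 first.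
- exact: mabs.
- apply/disj_setPS => y [] /=.
  by rewrite !in_itv/= => /andP[_ y0] /andP[+ _]; rewrite ltNge y0.
rewrite integral_itv_obnd_cbnd; last exact: mabs.
rewrite [X in X + _](eq_integral (fun y : measurableTypeR R => (-1 * (y : R))%:E)); last first.
  move=> y; rewrite inE/= in_itv/= => /andP[_ y0].
  by rewrite ler0_norm// mulN1r.
rewrite [X in _ + X](eq_integral (fun y : measurableTypeR R => (1 * (y : R))%:E)); last first.
  move=> y; rewrite inE/= in_itv/= => /andP[y0 _].
  by rewrite ger0_norm// mul1r.
rewrite !integral_linear; [|lra|lra].
by rewrite -EFinD -EFinM; congr EFin; field.
Qed.
End absolute_moment.


Section coordinates_measurable.
Context d (T : measurableType d) (R : realType).

Lemma measurable_select (N : T -> nat) (H : nat -> T -> R) (n : nat) :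
  measurable_fun setT N -> (forall t, (1 <= N t <= n)%N) ->
  (forall k, (1 <= k <= n)%N -> measurable_fun setT (H k)) ->
  measurable_fun setT (fun t => H (N t) t).
Proof.
move=> mN Nn mH.
pose G k t := if (1 <= k <= n)%N then H k t * (N t == k)%:R else 0.
rewrite (_ : (fun t => _) = (fun t => \sum_(1 <= k < n.+1) G k t)).
  apply: measurable_sum => k; rewrite /G.
  have [kn|_] := boolP (1 <= k <= n)%N; last exact: measurable_cst.
  apply: measurable_funM; first exact: mH.
  by apply: (measurableT_comp (f := fun j : nat => (j == k)%:R : R)).
apply/funext => t; have := Nn t => Nt.
rewrite (bigD1_seq (N t)) ?iota_uniq ?mem_index_iota ?ltnS//=.
rewrite /G Nt eqxx mulr1 big1 ?addr0// => k /negbTE.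
by rewrite eq_sym => ->; rewrite mulr0; case: ifP.
Qed.

Lemma measurable_sum_nat (F : nat -> T -> R) (m n : nat) :
  (forall k, (m <= k < n)%N -> measurable_fun setT (F k)) ->
  measurable_fun setT (fun t => \sum_(m <= k < n) F k t).
Proof.
move=> mF; pose G k t := if (m <= k < n)%N then F k t else 0.
rewrite (_ : (fun t => _) = (fun t => \sum_(m <= k < n) G k t)).
  apply: measurable_sum => k; rewrite /G.
  by have [kn|_] := boolP (m <= k < n)%N; [exact: mF|exact: measurable_cst].
by apply/funext => t; apply: eq_big_nat => k kn; rewrite /G kn.
Qed.

Lemma measurable_bigmine (s : seq nat) (Q : pred nat) (F : nat -> T -> \bar R) :
  (forall j, j \in s -> Q j -> measurable_fun setT (F j)) ->
  measurable_fun setT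
    (fun t => (\big[Order.min/+oo%E]_(j <- s | Q j) F j t)).
Proof.
elim: s => [|j s IH] mF.
  by under eq_fun do rewrite big_nil; exact: measurable_cst.
have ms : measurable_fun setT
    (fun t => (\big[Order.min/+oo%E]_(j <- s | Q j) F j t)).
  by apply: IH => i si; apply: mF; rewrite in_cons si orbT.
under eq_fun do rewrite big_cons.
have [Qj|//] := boolP (Q j); apply: measurable_mine => //.
by apply: mF => //; exact: mem_head.
Qed.

Lemma measurable_nn_dist (x : nat -> T -> R) (n k : nat) :
  (forall j, (1 <= j <= n)%N -> measurable_fun setT (x j)) ->
  (1 <= k <= n)%N -> measurable_fun setT (fun t => nn_dist (x ^~ t) n k).
Proof.
move=> mx kn; apply: (measurableT_comp (fine_measurable _)) => //.
apply: (@measurable_bigmine _ _ (fun j t => `|x k t - x j t|%:E)) => j.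
rewrite mem_index_iota ltnS => jn _; apply/measurable_EFinP.
apply: measurableT_comp => //.
by apply: measurable_funB; exact: mx.
Qed.

End coordinates_measurable.

(** * The past of the process *)

Section past.
Context (R : realType) d (T : measurableType d) (P : probability T R).
Context (n0 : nat) (chi : nat -> {RV P >-> nat})
  (psi : nat -> {RV P >-> measurableTypeR R}).

Let chis a (A : nat -> set nat) := \big[setI/setT]_(n0 <= i < a) (chi i @^-1` A i).
Let psis b (B : nat -> set (measurableTypeR R)) :=
  \big[setI/setT]_(n0.+1 <= j < b) (psi j @^-1` B j).

(** A pi-system generating the sigma-algebra of [chi i] for [n0 <= i < a] and
    [psi j] for [n0 < j < b].  The positions [x_1, ..., x_n] are measurable for
    [a = n] and [b = n.+1], the parent of [x_(n+1)] is so for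
    [a = b = n.+1]. *)
Definition past (a b : nat) : set (set T) := [set E | exists A B,
  [/\ forall i, measurable (A i), forall j, measurable (B j) &
   E = chis a A `&` psis b B]].

Let measurable_chi i A : measurable A -> measurable (chi i @^-1` A).
Proof. by move=> mA; rewrite -[X in measurable X]setTI; exact: measurable_funP. Qed.

Let measurable_psi i A : measurable A -> measurable (psi i @^-1` A).
Proof. by move=> mA; rewrite -[X in measurable X]setTI; exact: measurable_funP. Qed.

Lemma past_measurable a b : past a b `<=` measurable.
Proof.
move=> _ [A [B [mA mB ->]]]; apply: measurableI; apply: bigsetI_measurable.
  by move=> i _; exact: measurable_chi.
by move=> i _; exact: measurable_psi.
Qed.

Lemma pastI a b : setI_closed (past a b).
Proof.
move=> _ _ [A [B [mA mB ->]]] [A' [B' [mA' mB' ->]]].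
exists (fun i => A i `&` A' i), (fun i => B i `&` B' i); split.
- by move=> i; exact: measurableI.
- by move=> i; exact: measurableI.
- by rewrite setIACA /chis /psis -!big_split.
Qed.

Lemma past_setT a b : past a b setT.
Proof.
exists (fun=> setT), (fun=> setT); split => //.
by rewrite /chis /psis !big1// setTI.
Qed.

Lemma measurable_chi_past a b i : (n0 <= i < a)%N ->
  measurable_fun setT (chi i : g_sigma_algebraType (past a b) -> nat).
Proof.
move=> ia _ A mA; rewrite setTI; apply: sub_sigma_algebra.
exists (fun j => if j == i then A else setT), (fun=> setT); split => //.
rewrite /chis /psis [X in _ `&` X]big1 ?setIT//.
rewrite (bigD1_seq i) ?iota_uniq ?mem_index_iota//= eqxx.
by rewrite big1 ?setIT// => j /negbTE ->; rewrite preimage_setT.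
Qed.

Lemma measurable_psi_past a b i : (n0 < i < b)%N ->
  measurable_fun setT (psi i : g_sigma_algebraType (past a b) -> R).
Proof.
move=> ia _ A mA; rewrite setTI; apply: sub_sigma_algebra.
exists (fun=> setT), (fun j => if j == i then A else setT); split => //.
  by move=> j; case: ifP.
rewrite /chis /psis [X in X `&` _]big1 ?setTI//.
rewrite (bigD1_seq i) ?iota_uniq ?mem_index_iota//= eqxx.
by rewrite big1 ?setIT// => j /negbTE ->; rewrite preimage_setT.
Qed.

Lemma measurable_fun_past a b d' (U : measurableType d') (H : T -> U) :
  measurable_fun setT (H : g_sigma_algebraType (past a b) -> U) ->
  measurable_fun setT H.
Proof.
move=> mH _ A mA.
have : <<s past a b >> `<=` measurable.
  apply: smallest_sub; [exact: sigma_algebra_measurable|exact: past_measurable].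
by apply; apply: mH.
Qed.

Hypothesis chi_indep : independent_seq [set n | (n0 <= n)%N] chi.
Hypothesis psi_indep : independent_seq [set n | (n0 < n)%N] psi.
Hypothesis chi_psi_indep : independent_systems P
  (sigma_generated [set n | (n0 <= n)%N] chi)
  (sigma_generated [set n | (n0 < n)%N] psi).
Local Open Scope ereal_scope.

Let prob_past a b A B : (forall i, measurable (A i)) ->
  (forall j, measurable (B j)) ->
  P (chis a A `&` psis b B) =
  \prod_(n0 <= i < a) P (chi i @^-1` A i) *
  \prod_(n0.+1 <= j < b) P (psi j @^-1` B j).
Proof.
move=> mA mB; rewrite chi_psi_indep.
- congr (_ * _).
    apply: chi_indep => //; first exact: iota_uniq.
    by move=> i; rewrite mem_index_iota => /andP[].
  apply: psi_indep => //; first exact: iota_uniq.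
  by move=> i; rewrite mem_index_iota => /andP[].
- rewrite /chis big_seq.
  apply: (@bigsetI_measurable _ (g_sigma_algebraType
    (\bigcup_(n in [set n | (n0 <= n)%N]) preimage_set_system setT (chi n) measurable))).
  move=> i; rewrite mem_index_iota => /andP[n0i _]; apply: sub_sigma_algebra.
  by exists i => //; exists (A i) => //; rewrite setTI.
- rewrite /psis big_seq.
  apply: (@bigsetI_measurable _ (g_sigma_algebraType
    (\bigcup_(n in [set n | (n0 < n)%N]) preimage_set_system setT (psi n) measurable))).
  move=> i; rewrite mem_index_iota => /andP[n0i _]; apply: sub_sigma_algebra.
  by exists i => //; exists (B i) => //; rewrite setTI.
Qed.

Lemma past_indep_chi a b E A : (n0 <= a)%N -> past a b E ->
  P (E `&` chi a @^-1` A) = P E * P (chi a @^-1` A).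
Proof.
move=> n0a [A' [B [mA' mB ->]]].
pose A'' i := if i == a then A else A' i.
have A''E i : (n0 <= i < a)%N -> A'' i = A' i.
  by rewrite /A'' => /andP[_ /ltn_eqF ->].
have -> : chis a A' `&` psis b B `&` chi a @^-1` A = chis a.+1 A'' `&` psis b B.
  rewrite setIAC; congr (_ `&` _).
  rewrite /chis big_nat_recr//= {2}/A'' eqxx; congr (_ `&` _).
  by apply: eq_big_nat => i /A''E ->.
rewrite !prob_past// big_nat_recr//= {2}/A'' eqxx.
rewrite muleAC; congr (_ * _ * _).
by apply: eq_big_nat => i /A''E ->.
Qed.

Lemma past_indep_psi a b E B : (n0 < b)%N -> past a b E -> measurable B ->
  P (E `&` psi b @^-1` B) = P E * P (psi b @^-1` B).
Proof.
move=> n0b [A [B' [mA mB' ->]]] mB.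
pose B'' i := if i == b then B else B' i.
have B''E i : (n0 < i < b)%N -> B'' i = B' i.
  by rewrite /B'' => /andP[_ /ltn_eqF ->].
have -> : chis a A `&` psis b B' `&` psi b @^-1` B = chis a A `&` psis b.+1 B''.
  rewrite -setIA; congr (_ `&` _).
  rewrite /psis big_nat_recr//= {2}/B'' eqxx; congr (_ `&` _).
  by apply: eq_big_nat => i /B''E ->.
rewrite !prob_past//; last by move=> j; rewrite /B''; case: ifP.
rewrite big_nat_recr//= {2}/B'' eqxx muleA; congr (_ * _ * _).
by apply: eq_big_nat => i /B''E ->.
Qed.

End past.

(** * Moments and almost sure convergence for the LISA process *)

Section lisa_process.
Context (R : realType) d (T : measurableType d) (P : probability T R).
Context (n0 : nat) (pts : n0.-tuple R) (chi : nat -> {RV P >-> nat})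
  (psi : nat -> {RV P >-> measurableTypeR R}) (x : nat -> T -> R).
Hypothesis n0_ge2 : (2 <= n0)%N.
Hypothesis xL : is_lisa pts chi psi x.

Local Notation past_type a b := (g_sigma_algebraType (past n0 chi psi a b)).

Lemma chi_range n t : (n0 <= n)%N -> (1 <= chi n t <= n)%N.
Proof. by move=> n0n; have [+ _] := lisa_chi_unif xL n0n; exact. Qed.

Lemma measurable_lisa a b n k : (n0 <= n)%N -> (n <= a)%N -> (n < b)%N ->
  (1 <= k <= n)%N -> measurable_fun setT (x k : past_type a b -> R).
Proof.
elim: n k => [|n IH] k n0n na nb kn; first by lia.
have init j : (1 <= j <= n0)%N -> measurable_fun setT (x j : past_type a b -> R).
  move=> jn; have j0 : (j.-1 < n0)%N by lia.
  rewrite (_ : x j = fun=> tnth pts (Ordinal j0)); first exact: measurable_cst.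
  by apply/funext => t; rewrite -(lisa_init xL (Ordinal j0) t)/= prednK//; lia.
have [kn0|n0k] := leqP k n0; first by apply: init; lia.
have [kn'|nk] := leqP k n; first by apply: IH; lia.
have -> : k = n.+1 by lia.
have n0n' : (n0 <= n)%N by lia.
have mx j : (1 <= j <= n)%N -> measurable_fun setT (x j : past_type a b -> R).
  by move=> jn; apply: IH; lia.
have mchi : measurable_fun setT (chi n : past_type a b -> nat).
  by apply: measurable_chi_past; lia.
rewrite (_ : x n.+1 = fun t => x (chi n t) t +
    nn_dist (x ^~ t) n (chi n t) * psi n.+1 t); last first.
  by apply/funext => t; rewrite (lisa_step xL).
apply: measurable_funD.
  apply: (@measurable_select _ (past_type a b) R (chi n) x n) => // t.
  exact: chi_range.
apply: measurable_funM; last by apply: measurable_psi_past; lia.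
apply: (@measurable_select _ (past_type a b) R (chi n)
  (fun k t => nn_dist (x ^~ t) n k) n) => //.
- by move=> t; exact: chi_range.
- by move=> j jn; apply: measurable_nn_dist.
Qed.

Local Open Scope ereal_scope.

(** Conditionally on the past, [chi n] is uniform: averaging over it replaces
    the random index by the mean over all indices. *)
Lemma integral_choice n (H : nat -> T -> R) : (n0 <= n)%N ->
  (forall k t, (1 <= k <= n)%N -> (0 <= H k t)%R) ->
  (forall k, (1 <= k <= n)%N ->
    measurable_fun setT (H k : past_type n n.+1 -> R)) ->
  \int[P]_t (H (chi n t) t)%:E =
  \int[P]_t (n%:R^-1 * \sum_(1 <= k < n.+1) H k t)%:E.
Proof.
move=> n0n H0 mH.
pose G k t : R := if (1 <= k <= n)%N then H k t else 0%R.
have G0 k t : (0 <= (G k t)%:E).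
  by rewrite lee_fin /G; case: ifPn => // kn; exact: H0.
have mG k : measurable_fun setT (EFin \o G k : past_type n n.+1 -> \bar R).
  apply/measurable_EFinP; rewrite /G.
  by have [kn|_] := boolP (1 <= k <= n)%N; [exact: mH|exact: measurable_cst].
have mGT k : measurable_fun setT (EFin \o G k : T -> \bar R).
  exact: measurable_fun_past (mG k).
pose g k : nat -> \bar R := fun j => (\1_[set k] j)%:E.
have mg k : measurable_fun setT (fun t => g k (chi n t)).
  by apply: (measurableT_comp (f := g k)).
rewrite (eq_integral (fun t => \sum_(1 <= k < n.+1) ((G k t)%:E * g k (chi n t)))); last first.
  move=> t _; have Nt := chi_range t n0n.
  rewrite (bigD1_seq (chi n t)) ?iota_uniq ?mem_index_iota ?ltnS//=.
  rewrite /G Nt /g indicE mem_set// mule1 big1 ?adde0// => k /negbTE kt.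
  by rewrite indicE memNset ?mule0//= => /eqP; rewrite eq_sym kt.
rewrite ge0_integral_sum//; last 2 first.
- by move=> k; apply: emeasurable_funM; [exact: mGT|exact: mg].
- by move=> k t _; rewrite mule_ge0// lee_fin indicE.
rewrite (eq_integral (fun t => n%:R^-1%:E * \sum_(1 <= k < n.+1) (G k t)%:E)); last first.
  move=> t _; rewrite EFinM -sumEFin; congr (_ * _).
  by apply: eq_big_nat => k kn; rewrite /G ltnS in kn *; rewrite kn.
rewrite ge0_integralZl//; last 2 first.
- by apply: emeasurable_sum => k; exact: mGT.
- by move=> t _; apply: sume_ge0.
rewrite ge0_integral_sum// ge0_sume_distrr//; last first.
  by move=> k _; exact: integral_ge0.
apply: eq_big_nat => k kn; rewrite ltnS in kn.
rewrite (@ge0_integral_indepM _ _ _ _ _ P (past n0 chi psi n n.+1) (chi n) (EFin \o G k) (g k))//.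
- rewrite muleC; congr (_ * _); rewrite /g.
  have [_ chiP] := lisa_chi_unif xL n0n; rewrite -(chiP k)//.
  rewrite -[LHS]/(\int[P]_t (\1_(chi n @^-1` [set k]) t)%:E).
  by rewrite integral_indic ?setIT// -[X in measurable X]setTI; exact: measurable_funP.
- exact: past_measurable.
- exact: pastI.
- exact: past_setT.
- move=> E B EP _; apply: (past_indep_chi (lisa_chi_indep xL)
    (lisa_psi_indep xL) (lisa_chi_psi_indep xL) _ n0n EP).
- by move=> t; exact: G0.
- by move=> j; rewrite /g lee_fin indicE.
Qed.

(** The factor [2] compensates [E|psi| = 1/2]. *)
Lemma integral_jump n (H : T -> R) : (n0 <= n)%N -> (forall t, (0 <= H t)%R) ->
  measurable_fun setT (H : past_type n.+1 n.+1 -> R) ->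
  \int[P]_t (2 * (H t * `|psi n.+1 t|))%:E = \int[P]_t (H t)%:E.
Proof.
move=> n0n H0 mH.
have mabs : measurable_fun setT (fun y : measurableTypeR R => `|y : R|%:E).
  by apply/measurable_EFinP; exact: normr_measurable.
have mH' : measurable_fun setT (EFin \o H : past_type n.+1 n.+1 -> \bar R).
  exact/measurable_EFinP.
have mHT : measurable_fun setT (EFin \o H : T -> \bar R).
  exact: measurable_fun_past mH'.
have mpsi : measurable_fun setT (fun t => `|psi n.+1 t|%:E).
  by apply: (measurableT_comp mabs).
rewrite (eq_integral (fun t => 2%:E * ((H t)%:E * `|psi n.+1 t|%:E))); last first.
  by move=> t _; rewrite !EFinM.
rewrite ge0_integralZl//; last 2 first.
- by apply: emeasurable_funM.
- by move=> t _; rewrite mule_ge0// lee_fin.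
rewrite (@ge0_integral_indepM _ _ _ _ _ P (past n0 chi psi n.+1 n.+1) (psi n.+1)
  (EFin \o H) (fun y : measurableTypeR R => `|y : R|%:E))//.
- rewrite -(@ge0_integral_distribution _ _ _ _ _ P (psi n.+1) (fun y => `|y : R|%:E))//.
  rewrite (eq_measure_integral (unif (-1) 1)); last first.
    by move=> A mA _; apply: (lisa_psi_law xL).
  by rewrite integral_normr_unif muleCA -EFinM divff// mule1.
- exact: past_measurable.
- exact: pastI.
- exact: past_setT.
- move=> E B EP mB; apply: (past_indep_psi (lisa_chi_indep xL)
    (lisa_psi_indep xL) (lisa_chi_psi_indep xL) _ EP mB).
  by rewrite ltnS.
Qed.

Local Close Scope ereal_scope.

Let measurable_of_past n (H : T -> R) : measurable_fun setT (H : past_type n n.+1 -> R) ->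
  measurable_fun setT H.
Proof. exact: measurable_fun_past. Qed.

Lemma measurable_past_nn_dist a b n k : (n0 <= n)%N -> (n <= a)%N -> (n < b)%N ->
  (1 <= k <= n)%N ->
  measurable_fun setT ((fun t => nn_dist (x ^~ t) n k) : past_type a b -> R).
Proof.
move=> n0n na nb kn; apply: (@measurable_nn_dist _ (past_type a b)) => // j jn.
exact: (measurable_lisa n0n).
Qed.

Lemma measurable_past_nn_sum a b n : (n0 <= n)%N -> (n <= a)%N -> (n < b)%N ->
  measurable_fun setT ((fun t => nn_sum (x ^~ t) n) : past_type a b -> R).
Proof.
move=> n0n na nb; apply: (@measurable_sum_nat _ (past_type a b)) => k kn.
by apply: measurable_past_nn_dist => //; rewrite ltnS in kn.
Qed.

Definition parent_dist n t := nn_dist (x ^~ t) n (chi n t).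

Definition jump n t := parent_dist n t * `|psi n.+1 t|.

Lemma parent_dist_ge0 n t : 0 <= parent_dist n t.
Proof. exact: nn_dist_ge0. Qed.

Lemma jump_ge0 n t : 0 <= jump n t.
Proof. by rewrite mulr_ge0 ?parent_dist_ge0. Qed.

Lemma dist_parent n t : (n0 <= n)%N -> `|x n.+1 t - x (chi n t) t| = jump n t.
Proof.
move=> n0n; rewrite (lisa_step xL)// addrC addKr normrM ger0_norm//.
exact: nn_dist_ge0.
Qed.

Lemma measurable_parent_dist n : (n0 <= n)%N ->
  measurable_fun setT (parent_dist n : past_type n.+1 n.+1 -> R).
Proof.
move=> n0n; apply: (@measurable_select _ (past_type n.+1 n.+1) R (chi n)
  (fun k t => nn_dist (x ^~ t) n k) n).
- by apply: measurable_chi_past; rewrite n0n/=.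
- by move=> t; exact: chi_range.
- by move=> k kn; exact: measurable_past_nn_dist.
Qed.

Lemma measurable_jump n : (n0 <= n)%N -> measurable_fun setT (jump n).
Proof.
move=> n0n; apply: measurable_funM.
  exact: measurable_fun_past (measurable_parent_dist n0n).
apply: (measurableT_comp (f := fun y : measurableTypeR R => `|y : R|)) => //.
exact: normr_measurable.
Qed.

Lemma measurable_nn_sum n : (n0 <= n)%N ->
  measurable_fun setT (fun t => nn_sum (x ^~ t) n).
Proof.
by move=> n0n; apply: measurable_of_past; apply: (measurable_past_nn_sum n0n).
Qed.

Lemma nn_sum_step n t : (n0 <= n)%N ->
  nn_sum (x ^~ t) n.+1 <= nn_sum (x ^~ t) n - parent_dist n t + 2 * jump n t.
Proof.
move=> n0n; apply: nn_sumS; first exact: leq_trans n0n.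
  exact: chi_range.
exact: (lisa_step xL).
Qed.

Lemma parent_dist_le_nn_sum n t : (n0 <= n)%N ->
  parent_dist n t <= nn_sum (x ^~ t) n.
Proof.
move=> n0n; rewrite /nn_sum (bigD1_seq (chi n t)) ?iota_uniq//=; last first.
  by rewrite mem_index_iota ltnS chi_range.
by rewrite lerDl sumr_ge0// => k _; exact: nn_dist_ge0.
Qed.

(** The expected gain [2 E(jump n)] equals the expected loss
    [E(parent_dist n)]. *)
Lemma integral_nn_sum_nonincr n : (n0 <= n)%N ->
  (\int[P]_t (nn_sum (x ^~ t) n.+1)%:E <= \int[P]_t (nn_sum (x ^~ t) n)%:E)%E.
Proof.
move=> n0n.
have mS := measurable_nn_sum n0n.
have mD : measurable_fun setT (parent_dist n).
  exact: measurable_fun_past (measurable_parent_dist n0n).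
have mJ := measurable_jump n0n.
have SD0 t : 0 <= nn_sum (x ^~ t) n - parent_dist n t.
  by rewrite subr_ge0 parent_dist_le_nn_sum.
have mSD : measurable_fun setT (fun t => (nn_sum (x ^~ t) n - parent_dist n t)%:E).
  by apply/measurable_EFinP; apply: measurable_funB.
have mJ2 : measurable_fun setT (fun t => (2 * jump n t)%:E).
  by apply/measurable_EFinP; apply: measurable_funM.
apply: (@le_trans _ _ (\int[P]_t ((nn_sum (x ^~ t) n - parent_dist n t)%:E +
    (2 * jump n t)%:E))%E).
  apply: ge0_le_integral => //.
  - by move=> t _; rewrite lee_fin nn_sum_ge0.
  - by apply/measurable_EFinP; apply: measurable_nn_sum; exact: ltnW.
  - exact: emeasurable_funD.
  - by move=> t _; rewrite -EFinD lee_fin nn_sum_step.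
have J0 t : [set: T] t -> (0 <= (2 * jump n t)%:E)%E.
  by move=> _; rewrite lee_fin mulr_ge0// jump_ge0.
have SD0e t : [set: T] t -> (0 <= (nn_sum (x ^~ t) n - parent_dist n t)%:E)%E.
  by move=> _; rewrite lee_fin.
have D0 t : [set: T] t -> (0 <= (parent_dist n t)%:E)%E.
  by move=> _; rewrite lee_fin parent_dist_ge0.
have mDe : measurable_fun setT (fun t => (parent_dist n t)%:E) by exact/measurable_EFinP.
rewrite ge0_integralD//.
rewrite (integral_jump n0n (@parent_dist_ge0 n) (measurable_parent_dist n0n)).
rewrite -ge0_integralD//.
by rewrite le_eqVlt; apply/orP; left; apply/eqP; apply: eq_integral => t _;
  rewrite -EFinD subrK.
Qed.

Let init_sum := nn_sum (fun j => nth 0 pts j.-1) n0.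

Let x_init t j : (1 <= j <= n0)%N -> x j t = nth 0 pts j.-1.
Proof.
move=> jn; have j0 : (j.-1 < n0)%N by lia.
have := lisa_init xL (Ordinal j0) t.
by rewrite /= prednK ?(tnth_nth 0)//; lia.
Qed.

Let init_sum_ge0 : 0 <= init_sum. Proof. exact: nn_sum_ge0. Qed.

Lemma integral_nn_sum_le n : (n0 <= n)%N ->
  (\int[P]_t (nn_sum (x ^~ t) n)%:E <= init_sum%:E)%E.
Proof.
elim: n => [|n IH] n0n; first by lia.
have [n0n'|nn0] := leqP n0 n.
  exact: le_trans (integral_nn_sum_nonincr n0n') (IH n0n').
have -> : n.+1 = n0 by lia.
rewrite (eq_integral (cst init_sum%:E)); last first.
  by move=> t _; congr EFin; apply: eq_nn_sum => j /x_init.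
by rewrite integral_cst//= probability_setT mule1.
Qed.

Lemma integral_parent_dist_le n : (n0 <= n)%N ->
  (\int[P]_t (parent_dist n t)%:E <= (n%:R^-1 * init_sum)%:E)%E.
Proof.
move=> n0n.
rewrite (integral_choice (H := fun k t => nn_dist (x ^~ t) n k))//; last 2 first.
- by move=> k t _; exact: nn_dist_ge0.
- by move=> k kn; exact: measurable_past_nn_dist.
under eq_integral do rewrite EFinM.
rewrite ge0_integralZl//; last 2 first.
- by apply/measurable_EFinP; exact: measurable_nn_sum.
- by move=> t _; rewrite lee_fin; exact: nn_sum_ge0.
rewrite EFinM lee_wpmul2l ?lee_fin ?invr_ge0//.
exact: integral_nn_sum_le.
Qed.

Lemma integral_jump_le n : (n0 <= n)%N ->
  (\int[P]_t (jump n t)%:E <= (n%:R^-1 * init_sum)%:E)%E.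
Proof.
move=> n0n; apply: le_trans (integral_parent_dist_le n0n).
have mD := measurable_parent_dist n0n.
have mD2 : measurable_fun setT
    ((fun t => parent_dist n t / 2) : past_type n.+1 n.+1 -> R).
  by apply: (@measurable_funM _ (past_type n.+1 n.+1)).
rewrite (eq_integral (fun t => (2 * (parent_dist n t / 2 * `|psi n.+1 t|))%:E)); last first.
  by move=> t _; congr EFin; rewrite /jump; field.
rewrite (integral_jump n0n _ mD2)/=; last first.
  by move=> t; rewrite divr_ge0 ?parent_dist_ge0.
apply: ge0_le_integral => //.
- by move=> t _; rewrite lee_fin divr_ge0 ?parent_dist_ge0.
- by apply/measurable_EFinP; exact: measurable_fun_past mD2.
- by apply/measurable_EFinP; exact: measurable_fun_past mD.
- move=> t _; rewrite lee_fin ler_pdivrMr// ler_peMr ?parent_dist_ge0//.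
  by rewrite ler1n.
Qed.

(** [E(jump m)] is at most a constant over [m]. *)
Lemma ae_jump_summable : {ae P, forall t, exists M : R, forall N,
  \sum_(n0 <= m < N) jump m t / m.+1%:R <= M}.
Proof.
apply: (@ae_bounded_partial_sums _ _ _ _ n0 (fun m t => jump m t / m.+1%:R) init_sum).
- by move=> m t; rewrite divr_ge0 ?jump_ge0.
- by move=> m n0m; apply: measurable_funM => //; exact: measurable_jump.
- move=> N; apply: (@le_trans _ _ (init_sum * \sum_(n0 <= m < N) (m%:R ^+ 2)^-1)%:E); last first.
    by rewrite lee_fin -[leRHS]mulr1 ler_wpM2l// sum_inv_sqr_le1.
  rewrite mulr_sumr -sumEFin big_seq [leRHS]big_seq; apply: lee_sum => m.
  rewrite mem_index_iota => /andP[n0m _].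
  have m0 : 0 < m%:R :> R by rewrite ltr0n; lia.
  under eq_integral do rewrite mulrC EFinM.
  rewrite ge0_integralZl//; last 2 first.
  + by apply/measurable_EFinP; exact: measurable_jump.
  + by move=> t _; rewrite lee_fin; exact: jump_ge0.
  apply: (@le_trans _ _ ((m.+1%:R^-1)%:E * (m%:R^-1 * init_sum)%:E)%E).
    by rewrite lee_wpmul2l ?lee_fin ?invr_ge0// integral_jump_le.
  rewrite -EFinM lee_fin mulrA mulrC ler_wpM2l// expr2 invfM ler_wpM2r ?invr_ge0//.
  by rewrite lef_pV2 ?posrE// ler_nat.
Qed.

Lemma measurable_lisaT k : (1 <= k)%N -> measurable_fun setT (x k).
Proof.
move=> k1; apply: (@measurable_of_past (maxn k n0)); apply: (measurable_lisa (n := maxn k n0)) => //.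
  exact: leq_maxr.
by rewrite k1 leq_maxl.
Qed.

Let init_abs := \sum_(1 <= k < n0.+1) `|nth 0 pts k.-1|.

(** A child is at most [jump] further from the origin than its uniformly chosen
    parent, so the expected mean of [`|x k|] grows by [O(1 / n^2)] at each
    step. *)
Let integral_abs_mean_le n : (n0 <= n)%N ->
  (\int[P]_t (emp_mean (fun y => `|y|) (x ^~ t) n)%:E <= (init_abs + init_sum)%:E)%E.
Proof.
move=> n0n.
pose A n t := \sum_(1 <= k < n.+1) `|x k t|.
pose C n := init_abs + init_sum * \sum_(n0 <= m < n) (m%:R ^+ 2)^-1.
have A0 m t : 0 <= A m t by apply: sumr_ge0.
have mabs k : (1 <= k)%N -> measurable_fun setT (fun t => `|x k t|).
  by move=> k1; apply: measurableT_comp => //; exact: measurable_lisaT.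
have mA m : measurable_fun setT (A m).
  by apply: measurable_sum_nat => k /andP[k1 _]; exact: mabs.
have meanE m : (0 < m)%N ->
    (\int[P]_t (emp_mean (fun y => `|y|) (x ^~ t) m)%:E = (m%:R^-1)%:E * \int[P]_t (A m t)%:E)%E.
  move=> m0; under eq_integral do rewrite /emp_mean EFinM.
  have mA' : measurable_fun setT (fun t => (A m t)%:E) by exact/measurable_EFinP.
  have A0' t : [set: T] t -> (0 <= (A m t)%:E)%E by move=> _; rewrite lee_fin A0.
  by rewrite ge0_integralZl// lee_fin invr_ge0.
have intA m : (n0 <= m)%N -> (\int[P]_t (A m t)%:E <= (m%:R * C m)%:E)%E.
  elim: m => [|m IH] n0m; first by lia.
  have [n0m'|mn0] := leqP n0 m; last first.
    have mE : m.+1 = n0 by lia.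
    rewrite (eq_integral (cst init_abs%:E)); last first.
      move=> t _; congr EFin; rewrite /A mE; apply: eq_big_nat => k kn.
      by rewrite x_init.
    rewrite integral_cst//= probability_setT mule1 lee_fin /C mE big_geq// mulr0 addr0.
    by rewrite ler_peMl ?sumr_ge0// ler1n; lia.
  have {}IH := IH n0m'.
  have m0 : 0 < m%:R :> R by rewrite ltr0n; lia.
  have mchi : measurable_fun setT (fun t => `|x (chi m t) t|).
    apply: measurableT_comp => //.
    apply: (@measurable_select _ _ _ (chi m) x m) => //.
      by move=> t; exact: chi_range.
    by move=> k /andP[k1 _]; exact: measurable_lisaT.
  have chi_mean : (\int[P]_t (`|x (chi m t) t|)%:E <= (C m)%:E)%E.
    rewrite (integral_choice (H := fun k t => `|x k t|))//; last first.
      move=> k km; apply: (@measurableT_comp _ _ _ (past_type m m.+1)) => //.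
      exact: (measurable_lisa n0m').
    rewrite meanE; last by lia.
    rewrite (_ : C m = m%:R^-1 * (m%:R * C m)); last by rewrite mulKf// gt_eqF.
    by rewrite EFinM lee_wpmul2l ?lee_fin ?invr_ge0.
  have stepA t : A m.+1 t <= A m t + (`|x (chi m t) t| + jump m t).
    rewrite /A big_nat_recr//= lerD2l -(dist_parent t n0m').
    by rewrite -{1}(subrK (x (chi m t) t) (x m.+1 t)) addrC ler_normD.
  have mJ := measurable_jump n0m'.
  apply: (@le_trans _ _ (\int[P]_t ((A m t)%:E + ((`|x (chi m t) t|)%:E + (jump m t)%:E)))%E).
    apply: ge0_le_integral => //.
    - by move=> t _; rewrite lee_fin; exact: A0.
    - exact/measurable_EFinP.
    - by apply/measurable_EFinP; apply: measurable_funD => //; apply: measurable_funD.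
    - by move=> t _; rewrite -!EFinD lee_fin.
  have J0 t : [set: T] t -> (0 <= (jump m t)%:E)%E by move=> _; rewrite lee_fin jump_ge0.
  have A0' t : [set: T] t -> (0 <= (A m t)%:E)%E by move=> _; rewrite lee_fin A0.
  have X0 t : [set: T] t -> (0 <= `|x (chi m t) t|%:E)%E by move=> _; rewrite lee_fin.
  have mA' : measurable_fun setT (fun t => (A m t)%:E) by exact/measurable_EFinP.
  have mX' : measurable_fun setT (fun t => `|x (chi m t) t|%:E) by exact/measurable_EFinP.
  have mJ' : measurable_fun setT (fun t => (jump m t)%:E) by exact/measurable_EFinP.
  rewrite ge0_integralD//; last 2 first.
  - by move=> t tT; rewrite adde_ge0 ?X0 ?J0.
  - exact: emeasurable_funD.
  rewrite ge0_integralD//.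
  apply: (le_trans (leeD IH (leeD chi_mean (integral_jump_le n0m')))).
  rewrite -!EFinD lee_fin /C big_nat_recr//=.
  set Sg := \sum_(_ <= _ < _) _; rewrite -natr1 -subr_ge0.
  rewrite (_ : _ - _ = init_sum * (m%:R ^+ 2)^-1); last by field; rewrite gt_eqF.
  by rewrite mulr_ge0// invr_ge0 exprn_ge0.
have n00 : (0 < n)%N by lia.
rewrite meanE//; apply: (@le_trans _ _ (C n)%:E).
  rewrite (_ : C n = n%:R^-1 * (n%:R * C n)); last by rewrite mulKf// pnatr_eq0; lia.
  by rewrite EFinM lee_wpmul2l ?lee_fin ?invr_ge0// intA.
by rewrite lee_fin lerD2l -[leRHS]mulr1 ler_wpM2l// sum_inv_sqr_le1.
Qed.

Lemma integral_abs_mean_bounded : exists K : R, forall n, (n0 <= n)%N ->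
  (\int[P]_t (emp_mean (fun y => `|y|) (x ^~ t) n)%:E <= K%:E)%E.
Proof. by exists (init_abs + init_sum) => n; exact: integral_abs_mean_le. Qed.

Section empirical_means.
Variables (f : R -> R) (K : R).
Hypothesis mf : measurable_fun setT f.
Hypothesis f2K : forall n, (n0 <= n)%N ->
  (\int[P]_t (emp_mean (fun y => f y ^+ 2) (x ^~ t) n)%:E <= K%:E)%E.

(** The part of [emp_mean f] driven by the choice of the parents. *)
Definition martingale n t :=
  \sum_(n0 <= m < n) (f (x (chi m t) t) - emp_mean f (x ^~ t) m) / m.+1%:R.

Lemma measurable_past_emp_mean (g : R -> R) a b n : measurable_fun setT g ->
  (n0 <= n)%N -> (n <= a)%N -> (n < b)%N ->
  measurable_fun setT ((fun t => emp_mean g (x ^~ t) n) : past_type a b -> R).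
Proof.
move=> mg n0n na nb; apply: (@measurable_funM _ (past_type a b)).
  exact: measurable_cst.
apply: (@measurable_sum_nat _ (past_type a b)) => k; rewrite ltnS => kn.
by apply: (measurableT_comp mg); exact: (measurable_lisa n0n).
Qed.

Lemma measurable_emp_mean (g : R -> R) n : measurable_fun setT g -> (n0 <= n)%N ->
  measurable_fun setT (fun t => emp_mean g (x ^~ t) n).
Proof. by move=> mg n0n; apply: (@measurable_of_past n); exact: measurable_past_emp_mean. Qed.

Lemma measurable_past_martingale a b n : (n <= a)%N -> (n <= b)%N ->
  measurable_fun setT (martingale n : past_type a b -> R).
Proof.
move=> na nb; apply: (@measurable_sum_nat _ (past_type a b)) => m /andP[n0m mn].
apply: (@measurable_funM _ (past_type a b)); last exact: measurable_cst.
apply: (@measurable_funB _ (past_type a b)); last first.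
  by apply: measurable_past_emp_mean => //; [exact: ltnW (leq_trans mn na)|exact: leq_trans mn nb].
apply: (measurableT_comp mf).
apply: (@measurable_select _ (past_type a b) R (chi m) x m).
- by apply: measurable_chi_past; rewrite n0m (leq_trans mn na).
- by move=> t; exact: chi_range.
- move=> k km; apply: (measurable_lisa n0m) => //.
    exact: ltnW (leq_trans mn na).
  exact: leq_trans mn nb.
Qed.

(** Orthogonality of the increments, in the form of [emp_mean_sqr_le] under
    [integral_choice]. *)
Lemma martingale_sqr_le a b : (n0 <= a)%N -> (a <= b)%N ->
  (\int[P]_t ((martingale b t - martingale a t) ^+ 2)%:E <=
   (K * \sum_(a <= m < b) (m%:R ^+ 2)^-1)%:E)%E.
Proof.
move=> n0a; elim: b => [|b IH] ab.
  by exfalso; lia.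
have [ab'|ba] := leqP a b; last first.
  have -> : a = b.+1 by lia.
  under eq_integral do rewrite subrr expr0n/=.
  by rewrite integral0 big_geq// mulr0.
have n0b : (n0 <= b)%N by exact: leq_trans ab'.
have b0 : (0 < b)%N by lia.
pose Y t := martingale b t - martingale a t.
have mY : measurable_fun setT (Y : past_type b b.+1 -> R).
  by apply: (@measurable_funB _ (past_type b b.+1));
    apply: measurable_past_martingale => //; exact: leq_trans ab' _.
pose H k t := (Y t + (f (x k t) - emp_mean f (x ^~ t) b) * b.+1%:R^-1) ^+ 2.
have mH k : (1 <= k <= b)%N -> measurable_fun setT (H k : past_type b b.+1 -> R).
  move=> kb; apply: (@measurable_funX _ (past_type b b.+1)).
  apply: (@measurable_funD _ (past_type b b.+1)) => //.
  apply: (@measurable_funM _ (past_type b b.+1)); last exact: measurable_cst.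
  apply: (@measurable_funB _ (past_type b b.+1)); last exact: measurable_past_emp_mean.
  by apply: (measurableT_comp mf); exact: (measurable_lisa n0b).
rewrite (eq_integral (fun t => (H (chi b t) t)%:E)); last first.
  move=> t _; congr EFin; congr (_ ^+ 2).
  by rewrite /Y /martingale big_nat_recr//= addrAC.
rewrite integral_choice//; last by move=> k t _; exact: sqr_ge0.
have mY2 : measurable_fun setT (fun t => (Y t ^+ 2)%:E).
  by apply/measurable_EFinP; apply: measurable_funX; exact: measurable_fun_past mY.
have mf2 : measurable_fun setT (fun y => f y ^+ 2) by exact: measurable_funX.
have me : measurable_fun setT
    (fun t => (emp_mean (fun y => f y ^+ 2) (x ^~ t) b)%:E).
  apply/measurable_EFinP.
  by apply: (@measurable_of_past b); exact: measurable_past_emp_mean.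
have e0 t : [set: T] t -> (0 <= (emp_mean (fun y => f y ^+ 2) (x ^~ t) b)%:E)%E.
  by move=> _; rewrite lee_fin emp_mean_ge0// => y; exact: sqr_ge0.
have Y0 t : [set: T] t -> (0 <= (Y t ^+ 2)%:E)%E.
  by move=> _; rewrite lee_fin sqr_ge0.
have c0 : (0 <= ((b.+1%:R ^+ 2)^-1 : R)%:E)%E.
  by rewrite lee_fin invr_ge0 exprn_ge0.
apply: (@le_trans _ _ (\int[P]_t ((Y t ^+ 2)%:E + ((b.+1%:R ^+ 2)^-1 : R)%:E *
    (emp_mean (fun y => f y ^+ 2) (x ^~ t) b)%:E))%E).
  apply: ge0_le_integral => //.
  - move=> t _; rewrite lee_fin mulr_ge0 ?invr_ge0// sumr_ge0// => k _.
    exact: sqr_ge0.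
  - apply/measurable_EFinP; apply: measurable_funM; first exact: measurable_cst.
    apply: measurable_sum_nat => k; rewrite ltnS => kb.
    exact: measurable_fun_past (mH k kb).
  - by apply: emeasurable_funD => //; exact: emeasurable_funM.
  - move=> t _; rewrite -EFinM -EFinD lee_fin.
    by rewrite (le_trans (emp_mean_sqr_le _ _ _ _ b0))// exprVn mulrC.
rewrite ge0_integralD//; last 2 first.
- by move=> t tT; rewrite mule_ge0 ?e0.
- exact: emeasurable_funM.
rewrite ge0_integralZl//.
apply: (@le_trans _ _ ((K * \sum_(a <= m < b) (m%:R ^+ 2)^-1)%:E +
    ((b.+1%:R ^+ 2)^-1)%:E * K%:E)%E).
  by apply: leeD; [exact: IH|rewrite lee_wpmul2l// f2K].
rewrite -EFinM -EFinD lee_fin [in leRHS]big_nat_recr//= mulrDr lerD2l mulrC.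
have K0 : 0 <= K.
  by rewrite -lee_fin (le_trans _ (f2K n0b))// integral_ge0.
rewrite ler_wpM2l// lef_pV2 ?posrE ?exprn_gt0 ?ltr0n//.
by rewrite -!natrX ler_nat leq_exp2r.
Qed.

(** The variance of an increment between consecutive cubes is [O(k^-4)], hence
    still summable after multiplication by [k^2], as
    [cvgn_weighted_variation] requires. *)
Lemma ae_martingale_cubes : {ae P, forall t, cvgn (fun k => martingale (k ^ 3) t)}.
Proof.
have K0 : 0 <= K.
  rewrite -lee_fin (le_trans _ (f2K (leqnn n0)))// integral_ge0// => t _.
  by rewrite lee_fin emp_mean_ge0// => y; exact: sqr_ge0.
pose W k t := martingale (k.+1 ^ 3) t - martingale (k ^ 3) t.
have mW k : measurable_fun setT (W k).
  pose N := (k.+1 ^ 3)%N.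
  have kN : (k ^ 3 <= N)%N by rewrite leq_exp2r.
  by apply: (@measurable_of_past N); apply: (@measurable_funB _ (past_type N N.+1));
    apply: measurable_past_martingale => //; exact: leqW.
have W0 k t : 0 <= k%:R ^+ 2 * W k t ^+ 2 by rewrite mulr_ge0// sqr_ge0.
have mW2 k : measurable_fun setT (fun t => k%:R ^+ 2 * W k t ^+ 2).
  by apply: measurable_funM => //; exact: measurable_funX.
suff sumW N : (\sum_(n0 <= k < N) \int[P]_t (k%:R ^+ 2 * W k t ^+ 2)%:E <= (7 * K)%:E)%E.
  apply: filterS (ae_bounded_partial_sums W0 (fun k _ => mW2 k) sumW) => t [M MP].
  exact: (cvgn_weighted_variation n0_ge2 MP).
apply: (@le_trans _ _ ((7 * K) * \sum_(n0 <= k < N) (k%:R ^+ 2)^-1)%:E); last first.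
  by rewrite lee_fin -[leRHS]mulr1 ler_wpM2l ?mulr_ge0// sum_inv_sqr_le1.
rewrite mulr_sumr -sumEFin big_seq [leRHS]big_seq; apply: lee_sum => k.
rewrite mem_index_iota => /andP[n0k _].
have k0 : 0 < k%:R :> R by rewrite ltr0n; lia.
have W2m : measurable_fun setT (fun t => (W k t ^+ 2)%:E).
  by apply/measurable_EFinP; exact: measurable_funX.
under eq_integral do rewrite EFinM.
rewrite ge0_integralZl//; last by move=> t _; rewrite lee_fin sqr_ge0.
have n0k3 : (n0 <= k ^ 3)%N.
  by rewrite (leq_trans n0k)// -{1}(expn1 k) leq_pexp2l//; lia.
have k3k : (k ^ 3 <= k.+1 ^ 3)%N by rewrite leq_exp2r.
apply: (le_trans (lee_wpmul2l _ (martingale_sqr_le n0k3 k3k))).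
  by rewrite lee_fin exprn_ge0.
(* the block from k^3 to (k+1)^3 has at most 7k^2 terms, each at most k^-6 *)
have block : \sum_(k ^ 3 <= m < k.+1 ^ 3) (m%:R ^+ 2)^-1 <= 7 * (k%:R ^+ 4)^-1 :> R.
  apply: (@le_trans _ _ (\sum_(k ^ 3 <= m < k.+1 ^ 3) (k%:R ^+ 6)^-1)).
    apply: ler_sum_nat => m /andP[km _].
    have m0 : (0 < m)%N by rewrite (leq_trans _ km)// expn_gt0; lia.
    rewrite lef_pV2 ?posrE ?exprn_gt0// ?ltr0n// -!natrX ler_nat.
    by rewrite (expnM k 3 2) leq_exp2r.
  rewrite sumr_const_nat -[X in X <= _]mulr_natl.
  apply: (@le_trans _ _ ((7 * k ^ 2)%:R * (k%:R ^+ 6)^-1)).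
    by rewrite ler_wpM2r ?invr_ge0 ?exprn_ge0// ler_nat; nia.
  by rewrite natrM natrX le_eqVlt; apply/orP; left; apply/eqP; field; rewrite gt_eqF.
rewrite -EFinM lee_fin.
apply: (@le_trans _ _ (k%:R ^+ 2 * (K * (7 * (k%:R ^+ 4)^-1)))).
  by rewrite ler_wpM2l ?exprn_ge0// ler_wpM2l.
by rewrite le_eqVlt; apply/orP; left; apply/eqP; field; rewrite gt_eqF.
Qed.

(** Once the martingale part is removed, the increments of [emp_mean f] are at
    most [L * jump m / m.+1]. *)
Lemma ae_emp_mean_cvg (L : R) : (forall y, 0 <= f y) -> 0 <= L ->
  (forall u v, `|f u - f v| <= L * `|u - v|) ->
  {ae P, forall t, cvgn (emp_mean f (x ^~ t))}.
Proof.
move=> f0 L0 fL.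
apply: filterS2 ae_jump_summable ae_martingale_cubes => t [M MP] cvgW.
pose e n := emp_mean f (x ^~ t) n.
have cvg_drift : cvgn (fun n => e n - martingale n t).
  apply: (@cvgn_bounded_variation _ n0 _ (L * M)) => N.
  apply: le_trans (ler_wpM2l L0 (MP N)); rewrite mulr_sumr.
  apply: ler_sum_nat => m /andP[n0m _].
  rewrite /e emp_meanS; last by lia.
  rewrite /martingale big_nat_recr//= -/(martingale m t).
  rewrite (_ : _ - _ = (f (x m.+1 t) - f (x (chi m t) t)) / m.+1%:R); last by ring.
  rewrite normrM [X in _ * X <= _]ger0_norm ?invr_ge0// mulrA ler_wpM2r ?invr_ge0//.
  by rewrite -dist_parent.
have [r lim_r] : exists r : R, e n - martingale n t @[n --> \oo] --> r by apply/cvg_ex.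
have [w lim_w] : exists w : R, martingale (k ^ 3) t @[k --> \oo] --> w by apply/cvg_ex.
have cubes : (fun k : nat => (k ^ 3)%N) @ \oo --> \oo.
  apply/cvgnyPge => A; near=> k; rewrite (@leq_trans k)//; last first.
    by case: (k) => // k'; rewrite -{1}(expn1 k'.+1) leq_pexp2l.
  by near: k; exact: nbhs_infty_ge.
have lim_r3 : e (k ^ 3)%N - martingale (k ^ 3) t @[k --> \oo] --> r.
  exact: (cvg_comp _ _ cubes lim_r).
have lim_e : e (k ^ 3)%N @[k --> \oo] --> r + w.
  rewrite (_ : (fun k => e (k ^ 3)%N) =
    (fun k => e (k ^ 3)%N - martingale (k ^ 3) t + martingale (k ^ 3) t)).
    exact: cvgD lim_r3 lim_w.
  by apply/funext => k; rewrite subrK.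
apply/cvg_ex; exists (r + w).
apply: (@cvgn_mean_cubes _ (fun n => \sum_(1 <= k < n.+1) f (x k t))) => //.
- by move=> n; exact: sumr_ge0.
- move=> m n mn; rewrite [leRHS](@big_cat_nat _ _ _ m.+1)//= lerDl.
  exact: sumr_ge0.
Unshelve. all: by end_near.
Qed.

End empirical_means.

Lemma ae_nn_mean_cvg0 :
  {ae P, forall t, n%:R^-1 * nn_sum (x ^~ t) n @[n --> \oo] --> 0}.
Proof.
apply: filterS ae_jump_summable => t [M MP].
have S_le n : (n0 <= n)%N ->
    nn_sum (x ^~ t) n <= init_sum + 2 * \sum_(n0 <= m < n) jump m t.
  elim: n => [|n IH] n0n; first by exfalso; lia.
  have [n0n'|nn0] := leqP n0 n; last first.
    have -> : n.+1 = n0 by lia.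
    rewrite big_geq// mulr0 addr0 le_eqVlt; apply/orP; left; apply/eqP.
    by apply: eq_nn_sum => j /x_init.
  rewrite big_nat_recr//= mulrDr addrA.
  apply: le_trans (nn_sum_step t n0n') _; apply: lerD => //.
  by apply: le_trans (IH n0n'); rewrite lerBlDr lerDl parent_dist_ge0.
have lim_jump : n%:R^-1 * \sum_(n0 <= m < n) jump m t @[n --> \oo] --> 0.
  by apply: kronecker MP => m; exact: jump_ge0.
have lim_inv : n%:R^-1 @[n --> \oo] --> (0 : R).
  by rewrite -cvg_shiftS; exact: cvg_harmonic.
have lim_sum := cvgD (cvgM lim_inv (@cvg_cst _ init_sum _ \oo _))
  (cvgM (@cvg_cst _ (2 : R) _ \oo _) lim_jump).
rewrite mul0r mulr0 addr0 in lim_sum.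
apply: (@squeeze_cvgr _ _ _ _ (cst 0)
  (fun n => n%:R^-1 * init_sum + 2 * (n%:R^-1 * \sum_(n0 <= m < n) jump m t))).
- near=> n; rewrite mulr_ge0 ?invr_ge0 ?nn_sum_ge0//=.
  rewrite mulrCA -mulrDr ler_wpM2l ?invr_ge0// S_le//.
  by near: n; exact: nbhs_infty_ge.
- exact: cvg_cst.
- exact: lim_sum.
Unshelve. all: by end_near.
Qed.

End lisa_process.

(** * Distribution functions and Riemann sums *)

Section cdf_limit.
Context {R : realType}.
Local Notation BR := (measurableTypeR R).

Lemma compact_uniformly_continuous (f : R -> R) (a b e : R) :
  continuous f -> 0 < e -> exists2 del : R, 0 < del &
  forall x y, x \in `[a, b] -> `|x - y| < del -> `|f x - f y| < e.
Proof.
move=> cf e0.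
have /compact_near_coveringP cov := @segment_compact R a b.
have : \forall del \near (0 : R)^'+, [set` `[a, b]] `<=`
    (fun x => forall y, `|x - y| < del -> `|f x - f y| < e).
  apply: cov => x _.
  have e20 : 0 < e / 2 by lra.
  have /cvgrPdist_lt /(_ _ e20) /nbhs_ballP[r /= r0 rf] := cf x.
  exists (ball x (r / 2), [set del | del < r / 2]); first split => /=.
  - by apply: nbhsx_ballx; lra.
  - by apply: nbhs_right_lt; lra.
  case=> x' del /= [xx' delr] y x'y.
  have h1 : `|f x - f x'| < e / 2.
    by apply: rf; apply: le_ball xx'; lra.
  have h2 : `|f x - f y| < e / 2.
    apply: rf; rewrite /ball/= in xx' *.
    by rewrite (le_lt_trans (ler_distD x' _ _))//; lra.
  rewrite (le_lt_trans (ler_distD (f x) _ _))// distrC; lra.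
move=> near0; have [del [dab del0]] := filter_ex (filterI near0 (nbhs_right_gt 0)).
by exists del => // x y xab; exact: dab.
Unshelve. all: by end_near.
Qed.

Definition cumul (m : {measure set BR -> \bar R}) (a : R) : R :=
  fine (m `]-oo, a]%classic).

Section one_measure.
Variables (m : {measure set BR -> \bar R}) (m1 : m setT = 1%E).

Lemma total1_fin_num (A : set BR) : measurable A -> m A \is a fin_num.
Proof.
move=> mA; rewrite ge0_fin_numE//; apply: (@le_lt_trans _ _ (m setT)).
  by apply: le_measure; rewrite ?inE.
by rewrite m1 ltry.
Qed.

Lemma cumul_ge0 a : 0 <= cumul m a.
Proof. exact: fine_ge0. Qed.

Lemma cumul_le1 a : cumul m a <= 1.
Proof.
rewrite /cumul -lee_fin fineK ?total1_fin_num// -m1.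
by apply: le_measure; rewrite ?inE.
Qed.

Lemma le_cumul a b : a <= b -> cumul m a <= cumul m b.
Proof.
move=> ab; apply: fine_le; rewrite ?total1_fin_num//.
by apply: le_measure; rewrite ?inE//; apply: subset_itvl; rewrite bnd_simp.
Qed.

Lemma measure_Nyc r :
  m `]-oo, r]%classic = (m `]-oo, r[%classic + m [set r])%E.
Proof.
rewrite (@itv_bndbnd_setU _ _ -oo%O (BLeft r) (BRight r)) ?bnd_simp//.
rewrite set_itv1 measureU//.
by apply/seteqP; split => // x [] /=; rewrite in_itv/= => xr xE; rewrite xE ltxx in xr.
Qed.

Lemma measure_oc a b : a <= b ->
  fine (m `]a, b]%classic) = cumul m b - cumul m a.
Proof.
move=> ab; rewrite /cumul (@itv_bndbnd_setU _ _ -oo%O (BRight a) (BRight b))//.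
rewrite measureU//.
  by rewrite fineD ?total1_fin_num// [X in _ = X]addrC addKr.
apply/seteqP; split => // x [] /=; rewrite !in_itv/= => xa /andP[+ _].
by rewrite ltNge xa.
Qed.

Lemma measure_oy a : fine (m `]a, +oo[%classic) = 1 - cumul m a.
Proof.
have -> : 1 = fine (m setT) :> R by rewrite m1.
rewrite /cumul -(set_itvNyy R) (@itv_bndbnd_setU _ _ -oo%O (BRight a) +oo%O)//.
rewrite measureU//.
  by rewrite fineD ?total1_fin_num// [X in _ = X]addrC addKr.
apply/seteqP; split => // x [] /=; rewrite !in_itv/= andbT => xa.
by rewrite ltNge xa.
Qed.

Variables (f : R -> R) (K : R).
Hypotheses (cf : continuous f) (fK : forall y, `|f y| <= K).

Lemma integrable_bounded_continuous (A : set BR) : measurable A ->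
  m.-integrable A (EFin \o f).
Proof.
move=> mA; apply: measurable_bounded_integrable => //.
- by rewrite -ge0_fin_numE// total1_fin_num.
- by apply: measurable_funTS; exact: continuous_measurable_fun.
- by exists K; split; [exact: num_real|move=> M KM y _ /=; rewrite (le_trans (fK y)) ?ltW].
Qed.

Lemma Rintegral_near_cst (A : set BR) (v e : R) : measurable A ->
  (forall y, A y -> `|f y - v| <= e) ->
  `|\int[m]_(y in A) f y - v * fine (m A)| <= e * fine (m A).
Proof.
move=> mA fv.
have int_cst (c : R) : m.-integrable A (EFin \o cst c).
  apply: measurable_bounded_integrable => //.
    by rewrite -ge0_fin_numE// total1_fin_num.
  by exists `|c|; split; [exact: num_real|move=> M cM y _ /=; exact: ltW].
have intf := integrable_bounded_continuous mA.
have intB : m.-integrable A (EFin \o (fun y => f y - v)).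
  have := integrableB mA intf (int_cst v).
  by apply: eq_integrable.
rewrite -!Rintegral_cst// -RintegralB//.
apply: le_trans (le_normr_Rintegral _ _) _ => //.
apply: le_Rintegral => //.
- by have := integrable_norm intB.
- exact: int_cst.
- exact: int_cst.
Qed.

(** The last term accounts for the two tails outside the grid. *)
Lemma Rintegral_riemann_sum (c : nat -> R) (e : R) (N : nat) :
  (forall i, c i <= c i.+1) -> 0 <= e ->
  (forall i y, (i < N)%N -> y \in `]c i, c i.+1] -> `|f y - f (c i.+1)| <= e) ->
  `|\int[m]_y f y -
    \sum_(i < N) f (c i.+1) * (cumul m (c i.+1) - cumul m (c i))| <=
  e + K * (cumul m (c 0%N) + (1 - cumul m (c N))).
Proof.
move=> ndc e0 fc.
have step n : (n <= N)%N -> `|\int[m]_(y in `]-oo, c n]) f y -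
    \sum_(i < n) f (c i.+1) * (cumul m (c i.+1) - cumul m (c i))| <=
    e * (cumul m (c n) - cumul m (c 0%N)) + K * cumul m (c 0%N).
  elim: n => [_|n IH nN].
    rewrite big_ord0 subr0 subrr mulr0 add0r.
    have := @Rintegral_near_cst `]-oo, c 0%N]%classic 0 K.
    by rewrite mul0r subr0; apply => // y _; rewrite subr0.
  rewrite big_ord_recr/=.
  rewrite (@itv_bndbnd_setU _ _ -oo%O (BRight (c n)) (BRight (c n.+1)))//; last first.
    by rewrite bnd_simp.
  rewrite Rintegral_setU//; last 2 first.
  - by apply: integrable_bounded_continuous; exact: measurableU.
  - apply/disj_setPS => x [] /=; rewrite !in_itv/= => xa /andP[+ _].
    by rewrite ltNge xa.
  have := @Rintegral_near_cst `]c n, c n.+1]%classic (f (c n.+1)) e.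
  rewrite measure_oc// => /(_ _ _)/le_trans h.
  have {}IH := IH (ltnW nN).
  rewrite opprD addrACA (le_trans (ler_normD _ _))//.
  rewrite [leRHS](_ : _ = e * (cumul m (c n) - cumul m (c 0%N)) +
    K * cumul m (c 0%N) + e * (cumul m (c n.+1) - cumul m (c n))); last by ring.
  apply: lerD => //; apply: h => // y yc; apply: fc => //.
have -> : \int[m]_y f y = \int[m]_(y in `]-oo, c N]) f y + \int[m]_(y in `]c N, +oo[) f y.
  rewrite -Rintegral_setU//; last 2 first.
  - by apply: integrable_bounded_continuous; exact: measurableU.
  - apply/disj_setPS => x [] /=; rewrite !in_itv/= andbT => xa.
    by rewrite ltNge xa.
  by rewrite -itv_bndbnd_setU// set_itvNyy.
have tail : `|\int[m]_(y in `]c N, +oo[) f y| <= K * (1 - cumul m (c N)).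
  have := @Rintegral_near_cst `]c N, +oo[%classic 0 K.
  by rewrite mul0r subr0 measure_oy; apply => // y _; rewrite subr0.
have := step N (leqnn N); set S := \sum_(_ < _) _ => stepN.
rewrite addrAC (le_trans (ler_normD _ _))//.
rewrite mulrDr addrA lerD// (le_trans stepN)// lerD2r.
rewrite -[leRHS]mulr1 ler_wpM2l//.
by have := cumul_le1 (c N); have := cumul_ge0 (c 0%N); lra.
Qed.

End one_measure.
End cdf_limit.

(** * Weak limits from distribution functions *)

Section limit_law.
Context {R : realType}.
Local Notation BR := (measurableTypeR R).
Variable mu : nat -> {measure set BR -> \bar R}.
Hypothesis mu1 : \forall n \near \oo, mu n setT = 1%E.
Hypothesis squeeze : forall a b : R, a < b -> exists l : R, forall e : R, 0 < e ->
  \forall n \near \oo, cumul (mu n) a <= l + e /\ l - e <= cumul (mu n) b.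
Hypothesis tight : forall e : R, 0 < e -> exists M, \forall n \near \oo,
  cumul (mu n) (- M) <= e /\ 1 - e <= cumul (mu n) M.

Let upper x := [set c | exists2 b : R, x < b & \forall n \near \oo, cumul (mu n) b <= c].

(** The right-continuous upper envelope of the distribution functions:
    [inf_(b > x) limsup_n (mu n) `]-oo, b]]. *)
Definition limit_cdf (x : R) : R := inf (upper x).
Let G := limit_cdf.

Let upper_ge0 x c : upper x c -> 0 <= c.
Proof.
move=> [b _ bc]; have [n nc] := filter_ex bc.
by rewrite (le_trans _ nc)// cumul_ge0.
Qed.

Let upper1 x : upper x 1.
Proof.
exists (x + 1); first by lra.
by near=> n; apply: cumul_le1; near: n.
Unshelve. all: by end_near.
Qed.

Let has_inf_upper x : has_inf (upper x).
Proof. by split; [exists 1; exact: upper1|exists 0 => c /upper_ge0]. Qed.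

Let G_le x c : upper x c -> G x <= c.
Proof. by move=> xc; apply: ge_inf => //; have [] := has_inf_upper x. Qed.

Let G_ge0 x : 0 <= G x.
Proof. by apply: lb_le_inf; [exists 1; exact: upper1|move=> c /upper_ge0]. Qed.

Let G_adh (x e : R) : 0 < e -> exists2 c, upper x c & c < G x + e.
Proof. by move=> e0; exact: (inf_adherent e0 (has_inf_upper x)). Qed.

Let ndG : nondecreasing G.
Proof.
move=> x y xy; apply: lb_le_inf; first by exists 1; exact: upper1.
move=> c [b yb bc]; apply: G_le; exists b => //; exact: le_lt_trans yb.
Qed.

Let rcG : right_continuous G.
Proof.
move=> x; apply/cvgrPdist_lt => e e0.
have [c [b xb bc] cG] := G_adh x e0.
near=> y; rewrite distrC ger0_norm ?subr_ge0; last first.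
  by apply: ndG; apply: ltW; near: y; exact: nbhs_right_gt.
rewrite ltrBlDl (le_lt_trans _ cG)//; apply: G_le; exists b => //.
Unshelve. all: by end_near.
Qed.

Let cumul_le_G (x e : R) : 0 < e -> \forall n \near \oo, cumul (mu n) x <= G x + e.
Proof.
move=> e0; have [c [b xb bc] cG] := G_adh x e0.
near=> n; rewrite (le_trans _ (ltW cG))//.
rewrite (@le_trans _ _ (cumul (mu n) b))//; last by near: n.
by apply: le_cumul; [near: n|exact: ltW].
Unshelve. all: by end_near.
Qed.

Let G_le_cumul (x y e : R) : x < y -> 0 < e ->
  \forall n \near \oo, G x - e <= cumul (mu n) y.
Proof.
move=> xy e0; have e20 : 0 < e / 2 by lra.
have [l /(_ _ e20) near_l] := @squeeze ((x + y) / 2) y (ltac:(lra)).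
have Gl : G x <= l + e / 2.
  apply: G_le; exists ((x + y) / 2); first by lra.
  by apply: filterS near_l => n [].
by apply: filterS near_l => n [_]; lra.
Qed.

Let G_ge c x : upper x c -> forall e M : R, M <= x -> 
  (\forall n \near \oo, 1 - e <= cumul (mu n) M) -> 1 - e <= c.
Proof.
move=> [b xb bc] e M Mx eM.
have [n [[nc en] n1]] := filter_ex (filterI (filterI bc eM) mu1).
rewrite (le_trans en)// (le_trans _ nc)// le_cumul// (le_trans Mx)// ltW//.
Qed.

Let GNy : G @ -oo --> (0 : R).
Proof.
apply/cvgrPdist_le => e e0; have [M eM] := tight e0.
near=> x; rewrite sub0r normrN ger0_norm//; apply: G_le; exists (- M).
  by near: x; apply: nbhs_ninfty_lt; exact: num_real.
by apply: filterS eM => n [].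
Unshelve. all: by end_near.
Qed.

Let Gy : G @ +oo --> (1 : R).
Proof.
apply/cvgrPdist_le => e e0; have [M eM] := tight e0.
near=> x; rewrite ger0_norm ?subr_ge0; last exact/G_le/upper1.
rewrite lerBlDl -lerBlDr; apply: lb_le_inf; first by exists 1; exact: upper1.
move=> c xc; apply: (G_ge xc (M := M)).
  by near: x; apply: nbhs_pinfty_ge; exact: num_real.
by apply: filterS eM => n [].
Unshelve. all: by end_near.
Qed.

HB.instance Definition _ := isCumulative.Build R _ R G ndG rcG.
HB.instance Definition _ := isCumulativeBounded.Build R 0 1 G GNy Gy.

(** Helly: [squeeze] says that the limsup at [a] is below the liminf at [b]
    whenever [a < b], so the distribution functions converge wherever their
    envelope is continuous; [tight] prevents mass from escaping. *)
Lemma limit_law_exists : exists nu : probability BR R,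
  (forall x e : R, 0 < e ->
    \forall n \near \oo, cumul (mu n) x <= cumul nu x + e) /\
  (forall x y e : R, x < y -> 0 < e ->
    \forall n \near \oo, cumul nu x - e <= cumul (mu n) y).
Proof.
exists (lebesgue_stieltjes_measure G).
have nuE r : cumul (lebesgue_stieltjes_measure G) r = G r.
  rewrite /cumul [X in fine X](_ : _ = (G r)%:E)//.
  exact: (cdf_lebesgue_stieltjes_id G r).
by split => *; rewrite nuE; [exact: cumul_le_G|exact: G_le_cumul].
Qed.

End limit_law.

Section weak_convergence.
Context {R : realType}.
Local Notation BR := (measurableTypeR R).
Variable nu : probability BR R.

Let nu1 : nu setT = 1%E. Proof. exact: probability_setT. Qed.

Let left_continuous_no_atom (r e : R) : nu [set r] = 0%E -> 0 < e ->
  exists2 a, a < r & cumul nu r - e <= cumul nu a.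
Proof.
move=> nur e0.
have lim : nu `]-oo, (r - n.+1%:R^-1)]%classic @[n --> \oo] --> nu `]-oo, r[%classic.
  have -> : `]-oo, r[%classic = \bigcup_n `]-oo, (r - n.+1%:R^-1)]%classic :> set R.
    apply/seteqP; split => [y|y [n _]] /=; rewrite !in_itv/= => yr.
      have ry0 : 0 < r - y by lra.
      have [n] := ltr_add_invr ry0; rewrite add0r => nry.
      by exists n => //=; rewrite in_itv/= lerBrDr -lerBrDl ltW.
    by apply: le_lt_trans yr _; rewrite ltrBlDr ltrDl invr_gt0.
  apply: nondecreasing_cvg_mu => //; first exact: bigcup_measurable.
  move=> p q pq; apply/subsetPset; apply: subset_itvl; rewrite bnd_simp lerD2l lerN2.
  by rewrite lef_pV2 ?posrE// ler_nat.
have nur_eq : nu `]-oo, r]%classic = nu `]-oo, r[%classic.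
  by rewrite -[RHS]adde0 -nur; exact: measure_Nyc.
rewrite -nur_eq -(@fineK _ (nu `]-oo, r]%classic)) ?total1_fin_num// in lim.
have /fine_cvgP[_ /cvgrPdist_le /(_ _ e0) near_e] := lim.
have [n ne] := filter_ex near_e; exists (r - n.+1%:R^-1).
  by rewrite ltrBlDr ltrDl invr_gt0.
by move: ne => /ler_normlP[_]; rewrite /cumul/=; lra.
Qed.

Let no_atom_between (a b : R) : a < b ->
  exists2 r : R, a < r < b & nu [set r] = 0%E.
Proof.
move=> ab; apply: contrapT => noatom.
have mid : measurable_fun setT (idfun : BR -> R) by exact: measurable_id.
pose X : {RV nu >-> R} := HB.pack (idfun : BR -> R) (isMeasurableFun.Build _ _ _ _ _ mid).
have abX : `]a, b[%classic `<=` [set r | 0 < pmf X r].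
  move=> r /=; rewrite in_itv/= => abr; rewrite lt_neqAle pmf_ge0 andbT.
  apply/eqP => r0; apply: noatom; exists r => //.
  rewrite -[LHS](@fineK _ (nu [set r])) ?total1_fin_num//.
  by congr EFin; rewrite r0 /pmf; congr (fine (nu _)).
have := countable_lebesgue_measure0 (sub_countable (subset_card_le abX) (pmf_gt0_countable X)).
rewrite lebesgue_measure_itv/= lte_fin ab -EFinD => /eqP; rewrite eqe subr_eq0.
by rewrite gt_eqF.
Qed.

Let tails (e : R) : 0 < e -> exists2 M, 0 < M &
  cumul nu (- M) <= e /\ 1 - e <= cumul nu M.
Proof.
move=> e0.
have mid : measurable_fun setT (idfun : BR -> R) by exact: measurable_id.
pose X : {RV nu >-> R} := HB.pack (idfun : BR -> R) (isMeasurableFun.Build _ _ _ _ _ mid).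
have /fine_cvg/cvgrPdist_le/(_ _ e0) near1 := cvg_cdfy1 X.
have := cvg_cdfNy0 X; rewrite cvgNy_compNP => /fine_cvg/cvgrPdist_le/(_ _ e0) near0.
have [M [[M1 M0] Mpos]] :=
  filter_ex (filterI (filterI near1 near0) (nbhs_pinfty_gt (num_real (0 : R)))).
exists M => //; split.
  by move: M0 => /ler_normlP[]; rewrite /= /cumul sub0r opprK => + _; exact.
by move: M1 => /ler_normlP[_]; rewrite /= /cumul; lra.
Qed.

Variable mu : nat -> {measure set BR -> \bar R}.
Hypothesis mu1 : \forall n \near \oo, mu n setT = 1%E.
Hypothesis mu_le : forall x e : R, 0 < e ->
  \forall n \near \oo, cumul (mu n) x <= cumul nu x + e.
Hypothesis mu_ge : forall x y e : R, x < y -> 0 < e ->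
  \forall n \near \oo, cumul nu x - e <= cumul (mu n) y.

Let cumul_cvg (r : R) : nu [set r] = 0%E ->
  cumul (mu n) r @[n --> \oo] --> cumul nu r.
Proof.
move=> nur; apply/cvgrPdist_le => e e0; have e20 : 0 < e / 2 by lra.
have [a ar ge_a] := left_continuous_no_atom nur e20.
apply: filterS2 (mu_le r e0) (mu_ge ar e20) => n h1 h2.
by rewrite ler_norml; lra.
Qed.

Let cvg_lincomb N (w : nat -> R) (u : nat -> nat -> R) (l : nat -> R) :
  (forall i, u i n @[n --> \oo] --> l i) ->
  \sum_(i < N) w i * (u i.+1 n - u i n) @[n --> \oo] -->
  \sum_(i < N) w i * (l i.+1 - l i).
Proof.
move=> ul; elim: N => [|N IH].
  by rewrite big_ord0; under eq_fun do rewrite big_ord0; exact: cvg_cst.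
rewrite big_ord_recr/=; under eq_fun do rewrite big_ord_recr/=.
apply: cvgD => //; apply: cvgM; first exact: cvg_cst.
by apply: cvgB; exact: ul.
Qed.

Let grid (lo del : R) : 0 < del -> exists c : nat -> R,
  forall i, lo + i%:R * del < c i < lo + i.+1%:R * del /\ nu [set c i] = 0%E.
Proof.
move=> del0.
have ex i : exists r : R, lo + i%:R * del < r < lo + i.+1%:R * del /\ nu [set r] = 0%E.
  have [|r rr r0] := @no_atom_between (lo + i%:R * del) (lo + i.+1%:R * del).
    by rewrite -natr1; lra.
  by exists r.
by have [c cP] := choice ex; exists c.
Qed.

(** Replace [f] by a step function on a fine grid of points that are not atoms of
    [nu]; at such points the distribution functions converge. *)
Lemma weak_cvg_cumul : weak_cvg mu nu.
Proof.
move=> f cf [K0 [_ bK0]].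
pose K := `|K0| + 1.
have fK y : `|f y| <= K by apply: bK0 => //; rewrite ltr_pwDr// ler_norm.
have K0' : 0 <= K by rewrite addr_ge0.
have cvgR : \int[mu n]_y f y @[n --> \oo] --> \int[nu]_y f y.
  apply/cvgrPdist_le => e e0.
  pose d := e / (3 + 6 * K).
  have d0 : 0 < d by rewrite divr_gt0//; lra.
  have [M M0 [tailN tailP]] := tails d0.
  have [del del0 unif_f] := compact_uniformly_continuous (- M - 1) (M + 2) cf d0.
  pose h := Num.min del 1 / 2.
  have h0 : 0 < h by rewrite divr_gt0// lt_min del0 ltr01.
  have h2del : h + h <= del by rewrite /h -splitr ge_min lexx.
  have h21 : h + h <= 1 by rewrite /h -splitr ge_min lexx orbT.
  have [c cP] := grid (- M - 1) h0.
  pose N := (Num.truncn ((2 * M + 1) / h)).+1.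
  have Nlo : 2 * M + 1 < N%:R * h by rewrite -ltr_pdivrMr// /N truncnS_gt.
  have Nhi : N%:R * h <= 2 * M + 1 + h.
    rewrite /N -natr1 mulrDl mul1r lerD2r -ler_pdivlMr//.
    by rewrite truncn_le// divr_ge0//; lra.
  have cS i : - M - 1 + i%:R * h < c i /\ c i < - M - 1 + i%:R * h + h.
    by have [/andP[+ +] _] := cP i; rewrite -natr1 mulrDl mul1r addrA.
  have cS' i : - M - 1 + i%:R * h + h < c i.+1 /\ c i.+1 < - M - 1 + i%:R * h + h + h.
    by have := cS i.+1; rewrite -natr1 mulrDl mul1r addrA.
  have ndc i : c i <= c i.+1.
    by have [_ u] := cS i; have [v _] := cS' i; lra.
  have fc i y : (i < N)%N -> y \in `]c i, c i.+1] -> `|f y - f (c i.+1)| <= d.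
    move=> iN; rewrite in_itv/= => /andP[ciy yci]; rewrite distrC ltW//.
    have iNh : i%:R * h + h <= N%:R * h.
      by rewrite -[X in _ + X]mul1r -mulrDl natr1 ler_pM2r// ler_nat.
    have ih0 : 0 <= i%:R * h by rewrite mulr_ge0// ltW.
    have [u _] := cS i; have [v1 v2] := cS' i.
    apply: unif_f; first by rewrite in_itv/=; apply/andP; split; lra.
    by rewrite ger0_norm ?subr_ge0//; lra.
  have c0M : c 0%N <= - M by have [_] := cS 0%N; rewrite mul0r; lra.
  have cNM : M <= c N by have [+ _] := cS N; lra.
  have nu0 : cumul nu (c 0%N) <= d := le_trans (le_cumul nu1 c0M) tailN.
  have nuN : 1 - d <= cumul nu (c N) := le_trans tailP (le_cumul nu1 cNM).
  have err_nu := Rintegral_riemann_sum nu1 cf fK ndc (ltW d0) fc.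
  have lim i : cumul (mu n) (c i) @[n --> \oo] --> cumul nu (c i).
    by apply: cumul_cvg; have [_ +] := cP i; exact.
  have limA := @cvg_lincomb N (fun i => f (c i.+1)) (fun i n => cumul (mu n) (c i))
    (fun i => cumul nu (c i)) lim.
  near=> n.
  have mun1 : mu n setT = 1%E by near: n.
  have err_mu := Rintegral_riemann_sum mun1 cf fK ndc (ltW d0) fc.
  have A_lim : `|\sum_(i < N) f (c i.+1) * (cumul nu (c i.+1) - cumul nu (c i)) -
      \sum_(i < N) f (c i.+1) * (cumul (mu n) (c i.+1) - cumul (mu n) (c i))| <= d.
    by near: n; move/cvgrPdist_le : limA; apply.
  have lim0 : `|cumul nu (c 0%N) - cumul (mu n) (c 0%N)| <= d.
    by near: n; move/cvgrPdist_le : (lim 0%N); apply.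
  have limN : `|cumul nu (c N) - cumul (mu n) (c N)| <= d.
    by near: n; move/cvgrPdist_le : (lim N); apply.
  have bnd_nu : K * (cumul nu (c 0%N) + (1 - cumul nu (c N))) <= K * (2 * d).
    by apply: ler_wpM2l => //; lra.
  have bnd_mu : K * (cumul (mu n) (c 0%N) + (1 - cumul (mu n) (c N))) <= K * (4 * d).
    apply: ler_wpM2l => //; move: lim0 limN; rewrite !ler_norml => /andP[? ?] /andP[? ?]; lra.
  have eE : e = 3 * d + 6 * (K * d) by rewrite /d; field; lra.
  move: err_nu err_mu A_lim; rewrite !ler_norml => /andP[? ?] /andP[? ?] /andP[? ?].
  by rewrite eE; apply/andP; split; lra.
have int_fin (m : {measure set BR -> \bar R}) : m setT = 1%E ->
    (\int[m]_y (f y)%:E)%E \is a fin_num.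
  move=> m1; apply: integrable_fin_num => //.
  exact: (integrable_bounded_continuous m1 cf fK).
have nu_fin : (\int[nu]_y (f y)%:E)%E \is a fin_num by apply: int_fin; exact: nu1.
rewrite -(fineK nu_fin); apply/fine_cvgP; split; last exact: cvgR.
by apply: filterS mu1 => n /int_fin.
Unshelve. all: by end_near.
Qed.

End weak_convergence.

(** * The conditional laws and the test functions *)

Section uniform_cumul.
Context {R : realType}.
Implicit Types (l r a : R).

Lemma cumul_unif_left l r a : a < l -> cumul (unif l r) a = 0.
Proof.
move=> al; rewrite /cumul /unif; case: pselect => [lr|_].
  rewrite [X in fine X](_ : _ = 0%E)// -[LHS]/(uniform_prob lr _).
  rewrite /uniform_prob integral_uniform_pdf.
  rewrite (_ : _ `&` _ = set0) ?integral_set0//.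
  apply/seteqP; split => // y [] /=; rewrite !in_itv/= => ya /andP[ly _].
  by have := lt_le_trans al (le_trans ly ya); rewrite ltxx.
rewrite [X in fine X](_ : _ = \d_l `]-oo, a]%classic)// diracE memNset//= in_itv/=.
by move/(lt_le_trans al); rewrite ltxx.
Qed.

Lemma cumul_unif_right l r a : l <= r -> r <= a -> cumul (unif l r) a = 1.
Proof.
move=> lr ra; rewrite /cumul /unif; case: pselect => [lr'|_].
  rewrite [X in fine X](_ : _ = 1%E)// -[LHS]/(uniform_prob lr' _).
  apply: integral_uniform_pdf1 => // y /=; rewrite !in_itv/= => /andP[_ yr].
  exact: le_trans ra.
rewrite [X in fine X](_ : _ = \d_l `]-oo, a]%classic)// diracE mem_set//= in_itv/=.
exact: le_trans ra.
Qed.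

End uniform_cumul.

Section lisa_law.
Context {R : realType}.
Variable x : nat -> R.

Let U n i := unif (x i.+1 - nn_dist x n i.+1) (x i.+1 + nn_dist x n i.+1).

Lemma lisa_muE n (A : set (measurableTypeR R)) :
  lisa_mu x n A = ((n%:R^-1)%:E * \sum_(i < n) U n i A)%E.
Proof. by []. Qed.

Lemma lisa_mu_setT n : (0 < n)%N -> lisa_mu x n setT = 1%E.
Proof.
move=> n0; rewrite lisa_muE (eq_bigr (fun=> 1%E)) => [|i _]; last exact: probability_setT.
rewrite sumEFin sumr_const card_ord -EFinM; congr EFin.
by rewrite mulVf// pnatr_eq0 -lt0n.
Qed.

Lemma cumul_lisa_mu n a : (0 < n)%N ->
  cumul (lisa_mu x n) a = n%:R^-1 * \sum_(i < n) cumul (U n i) a.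
Proof.
move=> n0; rewrite {1}/cumul lisa_muE.
rewrite (eq_bigr (fun i : 'I_n => (cumul (U n i) a)%:E)) ?sumEFin// => i _.
by rewrite /cumul fineK// fin_num_measure.
Qed.

(** A uniform law centred at [x k] and of radius [d] charges [`]-oo, a]] only if
    [x k - d <= a], and charges its complement only if [x k + d > a]; moving
    the argument of [g] by [d] costs at most [L * d]. *)
Section lipschitz_bounds.
Variables (g : R -> R) (L c a : R).
Hypotheses (g0 : forall y, 0 <= g y) (L0 : 0 <= L) (c0 : 0 <= c).
Hypothesis gL : forall u v, `|g u - g v| <= L * `|u - v|.

Let nn_mean n := n%:R^-1 * nn_sum x n.

Let mean_bound n (w : nat -> R) : (0 < n)%N ->
  (forall k, w k <= g (x k.+1) + L * nn_dist x n k.+1) ->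
  n%:R^-1 * \sum_(i < n) w i <= emp_mean g x n + L * nn_mean n.
Proof.
move=> n0 wg; rewrite /emp_mean /nn_mean mulrCA -mulrDr ler_wpM2l ?invr_ge0//.
rewrite /nn_sum !big_add1/= !big_mkord mulr_sumr -big_split/=.
by apply: ler_sum => i _; exact: wg.
Qed.

Let gD y d : 0 <= d -> g (y + d) <= g y + L * d /\ g (y - d) <= g y + L * d.
Proof.
move=> d0; have := gL (y + d) y; have := gL (y - d) y.
rewrite (_ : y - d - y = - d); last by ring.
rewrite (_ : y + d - y = d); last by ring.
by rewrite normrN (ger0_norm d0) !ler_norml => /andP[_ ?] /andP[_ ?]; split; lra.
Qed.

Lemma cumul_lisa_mu_le n : (0 < n)%N -> (forall y, y <= a -> c <= g y) ->
  c * cumul (lisa_mu x n) a <= emp_mean g x n + L * nn_mean n.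
Proof.
move=> n0 cg; rewrite cumul_lisa_mu// mulrCA mulr_sumr.
apply: (@mean_bound n (fun i => c * cumul (U n i) a)) => // k.
have d0 := nn_dist_ge0 x n k.+1; have [_ gle] := gD (x k.+1) d0.
have [al|la] := ltP a (x k.+1 - nn_dist x n k.+1).
  by rewrite /U cumul_unif_left// mulr0 addr_ge0// mulr_ge0.
apply: le_trans gle; apply: le_trans (cg _ la).
by rewrite ler_piMr// cumul_le1//; exact: probability_setT.
Qed.

Lemma cumul_lisa_mu_ge n : (0 < n)%N -> (forall y, a < y -> c <= g y) ->
  c * (1 - cumul (lisa_mu x n) a) <= emp_mean g x n + L * nn_mean n.
Proof.
move=> n0 cg; rewrite cumul_lisa_mu//.
have -> : 1 - n%:R^-1 * \sum_(i < n) cumul (U n i) a =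
    n%:R^-1 * \sum_(i < n) (1 - cumul (U n i) a).
  rewrite sumrB sumr_const card_ord mulrBr mulVf// pnatr_eq0 -lt0n//.
rewrite mulrCA mulr_sumr; apply: (@mean_bound n (fun i => c * (1 - cumul (U n i) a))) => // k.
have d0 := nn_dist_ge0 x n k.+1; have [gle _] := gD (x k.+1) d0.
have [ra|ar] := leP (x k.+1 + nn_dist x n k.+1) a.
  rewrite /U cumul_unif_right//; last by rewrite lerD2l ge0_cp.
  by rewrite subrr mulr0 addr_ge0// mulr_ge0.
apply: le_trans gle; apply: le_trans (cg _ ar).
by rewrite ler_piMr// lerBlDr lerDl cumul_ge0.
Qed.

End lipschitz_bounds.
End lisa_law.

Section test_functions.
Context {R : realType}.
Implicit Types (a b y u v : R).

Definition ramp a b y : R := Num.min 1 (Num.max 0 ((b - y) / (b - a))).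

Lemma ramp_ge0 a b y : 0 <= ramp a b y.
Proof. by rewrite /ramp le_min ler01 le_max lexx. Qed.

Lemma ramp_le1 a b y : ramp a b y <= 1.
Proof. by rewrite /ramp ge_min lexx. Qed.

Lemma ramp_left a b y : a < b -> y <= a -> ramp a b y = 1.
Proof.
move=> ab ya; rewrite /ramp min_l// le_max; apply/orP; right.
by rewrite ler_pdivlMr ?subr_gt0// mul1r lerD2l lerN2.
Qed.

Lemma ramp_right a b y : a < b -> b <= y -> ramp a b y = 0.
Proof.
move=> ab yb; rewrite /ramp max_l ?min_r//.
by rewrite ler_pdivrMr ?subr_gt0// mul0r subr_le0.
Qed.

Lemma ramp_lipschitz a b u v : a < b ->
  `|ramp a b u - ramp a b v| <= (b - a)^-1 * `|u - v|.
Proof.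
move=> ab; have ba : 0 < b - a by rewrite subr_gt0.
set L := (b - a)^-1.
wlog uv : u v / u <= v.
  move=> h; have [/h//|/ltW/h] := leP u v.
  by rewrite distrC [X in _ * X]distrC.
rewrite [X in _ * X]distrC (ger0_norm (_ : 0 <= v - u)) ?subr_ge0//.
have step : (b - u) / (b - a) = (b - v) / (b - a) + L * (v - u).
  by rewrite /L; field; rewrite gt_eqF.
have : 0 <= L * (v - u) by rewrite mulr_ge0 ?subr_ge0// invr_ge0 ltW.
rewrite /ramp step; move: (L * (v - u)) ((b - v) / (b - a)) => z w z0.
have clamp (q : R) : [\/ q <= 0 /\ Num.min 1 (Num.max 0 q) = 0,
    0 <= q <= 1 /\ Num.min 1 (Num.max 0 q) = q |
    1 <= q /\ Num.min 1 (Num.max 0 q) = 1].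
  have [q0|/negbTE] := boolP (q <= 0).
    by constructor 1; rewrite max_l// min_r.
  rewrite leNgt => /negbFE q0; rewrite max_r; last exact: ltW.
  have [q1|/negbTE] := boolP (q <= 1); first by constructor 2; rewrite min_r//; split=> //; apply/andP; split=> //; exact: ltW.
  by rewrite leNgt => /negbFE q1; constructor 3; rewrite min_l ltW.
rewrite ler_norml.
by have [[? ->]|[/andP[? ?] ->]|[? ->]] := clamp w;
   have [[? ->]|[/andP[? ?] ->]|[? ->]] := clamp (w + z);
   apply/andP; split; lra.
Qed.

(** A Lipschitz function tending to infinity at infinity, but slowly enough for
    its square to have bounded expected mean under the empirical measures. *)
Definition sqrt_growth y : R := Num.sqrt (1 + `|y|).

Lemma sqrt_growth_ge1 y : 1 <= sqrt_growth y.
Proof. by rewrite -[leLHS]sqrtr1 ler_wsqrtr// lerDl. Qed.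

Lemma sqrt_growth_sqr y : sqrt_growth y ^+ 2 = 1 + `|y|.
Proof. by rewrite sqr_sqrtr// addr_ge0. Qed.

Lemma le_sqrt_growth u v : `|u| <= `|v| -> sqrt_growth u <= sqrt_growth v.
Proof. by move=> uv; rewrite ler_wsqrtr// lerD2l. Qed.

Lemma sqrt_growth_lipschitz u v : `|sqrt_growth u - sqrt_growth v| <= 1 * `|u - v|.
Proof.
have u1 := sqrt_growth_ge1 u; have v1 := sqrt_growth_ge1 v.
rewrite mul1r; apply: le_trans (ler_dist_dist u v).
rewrite (_ : `|u| - `|v| = sqrt_growth u ^+ 2 - sqrt_growth v ^+ 2); last first.
  by rewrite !sqrt_growth_sqr; ring.
rewrite subr_sqr normrM ler_peMr// ger0_norm; lra.
Qed.

End test_functions.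

(** * Convergence of the conditional laws *)

Section deterministic.
Context {R : realType}.
Variable x : nat -> R.
Hypothesis nn0 : n%:R^-1 * nn_sum x n @[n --> \oo] --> 0.
Hypothesis cvg_ramp : forall p q : rat, p < q ->
  cvgn (emp_mean (ramp (ratr p : R) (ratr q)) x).
Hypothesis cvg_growth : cvgn (emp_mean sqrt_growth x).

(** The mean of a ramp whose rational endpoints lie between [a] and [b]
    separates the distribution functions at [a] and [b]. *)
Let cumul_squeeze (a b : R) : a < b -> exists l : R, forall e : R, 0 < e ->
  \forall n \near \oo, cumul (lisa_mu x n) a <= l + e /\ l - e <= cumul (lisa_mu x n) b.
Proof.
move=> ab.
have [p /=] := rat_in_itvoo ab; rewrite in_itv/= => /andP[ap pb].
have [q /=] := rat_in_itvoo pb; rewrite in_itv/= => /andP[pq qb].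
have pq' : (ratr p : R) < ratr q := pq.
rewrite ltr_rat in pq.
have [l lim_l] : exists l : R, emp_mean (ramp (ratr p : R) (ratr q)) x @ \oo --> l.
  by apply/cvg_ex; exact: cvg_ramp.
exists l => e e0.
pose L : R := (ratr q - ratr p)^-1.
have L0 : 0 <= L by rewrite invr_ge0 subr_ge0 ltW.
have lim_err : L * (n%:R^-1 * nn_sum x n) @[n --> \oo] --> 0.
  by have := cvgM (@cvg_cst _ L _ \oo _) nn0; rewrite mulr0 => lim; exact: lim.
have e20 : 0 < e / 2 by lra.
near=> n.
have n0 : (0 < n)%N by near: n; exact: nbhs_infty_gt.
have err : `|0 - L * (n%:R^-1 * nn_sum x n)| <= e / 2.
  by near: n; move/cvgrPdist_le : lim_err; apply.
have dl : `|l - emp_mean (ramp (ratr p : R) (ratr q)) x n| <= e / 2.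
  by near: n; move/cvgrPdist_le : lim_l; apply.
have up := @cumul_lisa_mu_le _ x (ramp (ratr p : R) (ratr q)) L 1 a
  (ramp_ge0 _ _) L0 ler01 (fun u v => ramp_lipschitz u v pq') n n0 _.
have co_mean : emp_mean (fun y => 1 - ramp (ratr p : R) (ratr q) y) x n =
    1 - emp_mean (ramp (ratr p : R) (ratr q)) x n.
  rewrite /emp_mean sumrB sumr_const_nat subSS subn0 mulrBr mulVf//.
  by rewrite pnatr_eq0 -lt0n.
have down := @cumul_lisa_mu_ge _ x (fun y => 1 - ramp (ratr p : R) (ratr q) y) L 1 b
  _ L0 ler01 _ n n0 _.
move: err dl; rewrite !ler_norml => /andP[? ?] /andP[? ?].
split.
  have : 1 * cumul (lisa_mu x n) a <= emp_mean (ramp (ratr p : R) (ratr q)) x n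
      + L * (n%:R^-1 * nn_sum x n).
    by apply: up => y ya; rewrite ramp_left// (le_trans ya)// ltW.
  lra.
have : 1 * (1 - cumul (lisa_mu x n) b) <=
    emp_mean (fun y => 1 - ramp (ratr p : R) (ratr q) y) x n + L * (n%:R^-1 * nn_sum x n).
  apply: down.
  - by move=> y; rewrite subr_ge0 ramp_le1.
  - move=> u v; rewrite (_ : _ - _ = ramp (ratr p) (ratr q) v - ramp (ratr p) (ratr q) u).
      by rewrite [X in _ * X]distrC; exact: ramp_lipschitz.
    by ring.
  - by move=> y yb; rewrite ramp_right ?subr0// (le_trans (ltW qb))// ltW.
rewrite co_mean; lra.
Unshelve. all: by end_near.
Qed.

Let cumul_tight (e : R) : 0 < e -> exists M, \forall n \near \oo,
  cumul (lisa_mu x n) (- M) <= e /\ 1 - e <= cumul (lisa_mu x n) M.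
Proof.
move=> e0.
have [l lim_l] : exists l : R, emp_mean sqrt_growth x @ \oo --> l by apply/cvg_ex.
have lim_err : 1 * (n%:R^-1 * nn_sum x n) @[n --> \oo] --> 0.
  by under eq_fun do rewrite mul1r.
pose B := `|l| + 2; pose M := (B / e) ^+ 2.
have B0 : 0 < B by rewrite /B ltr_wpDl.
have M0 : 0 <= M by rewrite sqr_ge0.
have c0 : 0 <= sqrt_growth M by rewrite (le_trans ler01)// sqrt_growth_ge1.
have BeM : B <= sqrt_growth M * e.
  rewrite -ler_pdivrMr// -[leLHS](ger0_norm (_ : 0 <= B / e)); last first.
    by rewrite divr_ge0// ltW.
  by rewrite -sqrtr_sqr -/M ler_wsqrtr// (ger0_norm M0) lerDr.
exists M; near=> n.
have n0 : (0 < n)%N by near: n; exact: nbhs_infty_gt.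
have err : `|0 - 1 * (n%:R^-1 * nn_sum x n)| <= 1.
  by near: n; move/cvgrPdist_le : lim_err; apply.
have dl : `|l - emp_mean sqrt_growth x n| <= 1.
  by near: n; move/cvgrPdist_le : lim_l; apply.
have g0 y : 0 <= sqrt_growth y :> R by rewrite (le_trans ler01)// sqrt_growth_ge1.
have bound : emp_mean sqrt_growth x n + 1 * (n%:R^-1 * nn_sum x n) <= sqrt_growth M * e.
  apply: le_trans BeM; rewrite /B.
  by move: err dl (ler_norm l); rewrite !ler_norml => /andP[? ?] /andP[? ?] ?; lra.
have cpos : 0 < sqrt_growth M by rewrite (lt_le_trans ltr01)// sqrt_growth_ge1.
split.
  rewrite -(ler_pM2l cpos); apply: le_trans bound.
  apply: cumul_lisa_mu_le => //; first exact: sqrt_growth_lipschitz.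
  move=> y yM; apply: le_sqrt_growth.
  have y0 : y <= 0 by apply: le_trans yM _; rewrite oppr_le0.
  by rewrite (ger0_norm M0) (ler0_norm y0) lerNr.
rewrite lerBlDr -lerBlDl -(ler_pM2l cpos); apply: le_trans bound.
apply: cumul_lisa_mu_ge => //; first exact: sqrt_growth_lipschitz.
move=> y My; apply: le_sqrt_growth.
have y0 : 0 <= y by exact: le_trans M0 (ltW My).
by rewrite (ger0_norm M0) (ger0_norm y0) ltW.
Unshelve. all: by end_near.
Qed.

Lemma lisa_mu_weak_cvg : exists mustar : probability (measurableTypeR R) R,
  weak_cvg (lisa_mu x) mustar.
Proof.
have mu1 : \forall n \near \oo, lisa_mu x n setT = 1%E.
  by near=> n; apply: lisa_mu_setT; near: n; exact: nbhs_infty_gt.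
have [nu [nu_le nu_ge]] := limit_law_exists mu1 cumul_squeeze cumul_tight.
by exists nu; exact: weak_cvg_cumul.
Unshelve. all: by end_near.
Qed.

End deterministic.

Section test_function_means.
Context (R : realType) d (T : measurableType d) (P : probability T R).
Context (n0 : nat) (pts : n0.-tuple R) (chi : nat -> {RV P >-> nat})
  (psi : nat -> {RV P >-> measurableTypeR R}) (x : nat -> T -> R).
Hypothesis n0_ge2 : (2 <= n0)%N.
Hypothesis xL : is_lisa pts chi psi x.

Let lipschitz_measurable (g : R -> R) (L : R) : 0 <= L ->
  (forall u v, `|g u - g v| <= L * `|u - v|) -> measurable_fun setT g.
Proof.
move=> L0 gL; apply: continuous_measurable_fun => u.
have L1 : 0 < L + 1 by rewrite ltr_wpDl.
apply/cvgrPdist_le => e e0; near=> v.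
apply: le_trans (gL u v) _; apply: (@le_trans _ _ ((L + 1) * `|u - v|)).
  by rewrite ler_wpM2r// lerDl.
rewrite -ler_pdivlMl// mulrC; near: v.
by apply: (@cvgr_dist_le _ _ _ (nbhs u) _ id) => //; rewrite divr_gt0.
Unshelve. all: by end_near.
Qed.

Let integral_le1 (g : T -> R) : measurable_fun setT g ->
  (forall t, 0 <= g t <= 1) -> (\int[P]_t (g t)%:E <= 1)%E.
Proof.
move=> mg g01; have -> : (1 = \int[P]_t (cst 1%E t))%E.
  by rewrite integral_cst//= probability_setT mule1.
apply: ge0_le_integral => //; last by move=> t _; rewrite lee_fin; have /andP[] := g01 t.
- by move=> t _; rewrite lee_fin; have /andP[] := g01 t.
- exact/measurable_EFinP.
Qed.

Lemma ae_ramp_mean_cvg (p q : R) : p < q ->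
  {ae P, forall t, cvgn (emp_mean (ramp p q) (x ^~ t))}.
Proof.
move=> pq.
have L0 : 0 <= (q - p)^-1 by rewrite invr_ge0 subr_ge0 ltW.
have lip u v := ramp_lipschitz u v pq.
have mramp := lipschitz_measurable L0 lip.
apply: (@ae_emp_mean_cvg _ _ _ _ _ _ _ _ _ n0_ge2 xL _ 1 mramp _ _ (ramp_ge0 _ _) L0 lip).
move=> n n0n; apply: integral_le1.
  by apply: (measurable_emp_mean n0_ge2 xL) => //; exact: measurable_funX.
move=> t; rewrite emp_mean_ge0 => [|y]; last exact: sqr_ge0.
have n00 : 0 < n%:R :> R by rewrite ltr0n; lia.
rewrite /emp_mean ler_pdivrMl// mulr1.
apply: (@le_trans _ _ (\sum_(1 <= k < n.+1) 1)).
  by apply: ler_sum => k _; rewrite expr_le1// ?ramp_le1 ?ramp_ge0.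
by rewrite sumr_const_nat subSS subn0.
Qed.

Lemma ae_growth_mean_cvg :
  {ae P, forall t, cvgn (emp_mean sqrt_growth (x ^~ t))}.
Proof.
have [K intK] := integral_abs_mean_bounded n0_ge2 xL.
have mg := lipschitz_measurable ler01 (@sqrt_growth_lipschitz R).
apply: (@ae_emp_mean_cvg _ _ _ _ _ _ _ _ _ n0_ge2 xL _ (1 + K) mg _ 1) => //; last first.
- exact: sqrt_growth_lipschitz.
- by move=> y; rewrite (le_trans ler01)// sqrt_growth_ge1.
move=> n n0n.
have n00 : n%:R != 0 :> R by rewrite pnatr_eq0; lia.
have mabs : measurable_fun setT (fun t => (emp_mean (fun y => `|y|) (x ^~ t) n)%:E).
  apply/measurable_EFinP; apply: (measurable_emp_mean n0_ge2 xL) => //.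
rewrite (eq_integral (fun t => 1 + (emp_mean (fun y => `|y|) (x ^~ t) n)%:E)%E); last first.
  move=> t _; rewrite -EFinD; congr EFin; rewrite /emp_mean.
  under eq_bigr do rewrite sqrt_growth_sqr.
  by rewrite big_split/= sumr_const_nat subSS subn0 mulrDr mulVf.
rewrite ge0_integralD//; last first.
  by move=> t _; rewrite lee_fin emp_mean_ge0.
rewrite integral_cst//= probability_setT mule1 EFinD.
by apply: leeD => //; exact: intK.
Qed.

End test_function_means.

Theorem theorem3 (R : realType) (d : measure_display) (T : measurableType d)
  (P : probability T R) (n0 : nat) (pts : n0.-tuple R)
  (chi : nat -> {RV P >-> nat}) (psi : nat -> {RV P >-> measurableTypeR R})
  (x : nat -> T -> R) :
  (2 <= n0)%N -> uniq pts -> is_lisa pts chi psi x ->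
  {ae P, forall t, exists mustar : probability (measurableTypeR R) R,
    weak_cvg (lisa_mu (fun k => x k t)) mustar}.
Proof.
move=> n0_ge2 _ xL.
have ramps : {ae P, forall t, forall n, match unpickle n : option (rat * rat) with
    | Some (p, q) => p < q -> cvgn (emp_mean (ramp (ratr p : R) (ratr q)) (x ^~ t))
    | None => True end}.
  apply: ae_foralln => n; case: unpickle => [[p q]|]; last exact: aeW.
  have [pq|_] := boolP (p < q); last exact: aeW.
  have pqR : (ratr p : R) < ratr q by rewrite ltr_rat.
  by apply: filterS (ae_ramp_mean_cvg n0_ge2 xL pqR) => t.
apply: filterS3 ramps (ae_nn_mean_cvg0 n0_ge2 xL) (ae_growth_mean_cvg n0_ge2 xL).
move=> t rampt nnt growt; apply: lisa_mu_weak_cvg => // p q pq.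
by have := rampt (pickle (p, q)); rewrite pickleK; exact.
Qed.
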